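(* Let $\mathfrak g=\mathfrak{sl}_{r+1}$ and let $\widehat{\mathfrak q}=\widehat{\mathfrak q}(S,S')\subset\widehat{\mathfrak g}$ be a finite-dimensional standard seaweed subalgebra, where $S\subsetneq\widehat\Pi$ and $S'\subset\Pi$ (that is, $\alpha_0\notin S'$). Then $\widehat{\mathfrak q}$ is isomorphic either to $\mathfrak q\oplus\Bbbk d\oplus\Bbbk C$ or to a semi-direct product $(\mathfrak q\oplus\Bbbk d\oplus\Bbbk C)\ltimes\mathfrak z t^{-1}$, where $\mathfrak q=\mathfrak p(S\cap\Pi)\cap\mathfrak r^-$ is a seaweed in $\mathfrak g$ and $\mathfrak z$ is the centre of $\mathfrak n(S\cap\Pi)$.
   Context: The ground field $\Bbbk$ has characteristic zero. Let $\mathfrak t\subset\mathfrak b\subset\mathfrak g=\mathfrak{sl}_{r+1}$ be a Cartan and a Borel subalgebra, $\Pi=\{\alpha_1,\dots,\alpha_r\}$ the simple roots and $\lambda$ the highest root. The affine Kac–Moody algebra is $\widehat{\mathfrak g}=\mathfrak g[t,t^{-1}]\oplus\Bbbk C\oplus\Bbbk d$ with $C$ central, $[d,\xi t^k]=k\,\xi t^k$ and $[xt^k,yt^l]=[x,y]t^{k+l}+k\,\delta_{k,-l}(x,y)C$, where $(\,,\,)$ is the normalised invariant form on $\mathfrak g$. Put $\mathfrak h=\mathfrak t\oplus\Bbbk C\oplus\Bbbk d$, and let $\widehat\Pi=\Pi\sqcup\{\alpha_0\}$ be the set of simple roots of $\widehat{\mathfrak g}$, where $\alpha_0|_{\mathfrak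 t}=-\lambda$, $\alpha_0(d)=1$, $\alpha_0(C)=0$. Let $e_\alpha\in\mathfrak g$ be a root vector for a root $\alpha$ of $\mathfrak g$, and $e_{-\alpha_0}=e_\lambda t^{-1}$. Set $\widehat{\mathfrak b}=(\mathfrak b+\mathfrak h)\oplus t\mathfrak g[t]$. For $S\subset\widehat\Pi$, $\mathfrak p(S)\subset\widehat{\mathfrak g}$ is the subalgebra generated by $\widehat{\mathfrak b}$ and $\{e_{-\beta}\mid\beta\in S\}$. Let $\omega$ be an involution of $\widehat{\mathfrak g}$ with $\omega|_{\mathfrak h}=-\mathrm{id}$ and $\omega(\mathfrak g t^k)=\mathfrak g t^{-k}$ for all $k\in\mathbb Z$. Put $\widehat{\mathfrak q}(S,S')=\mathfrak p(S)\cap\omega(\mathfrak p(S'))$; it is finite-dimensional if and only if both $S$ and $S'$ are proper subsets of $\widehat\Pi$. In the claim, $\mathfrak p(S\cap\Pi)$ denotes the standard parabolic subalgebra of the finite-dimensional algebra $\mathfrak g$ associated with $S\cap\Pi$, i.e. generated by $\mathfrak b$ and $\{e_{-\beta}\mid\beta\in S\cap\Pi\}$; $\mathfrak n(S\cap\Pi)$ is its nilpotent radical; $\mathfrak r^-\subset\mathfrak g$ is the parabolic subalgebra generated by $\mathfrak b^-=\omega(\mathfrak b)$ and $\{e_\beta\mid\beta\in S'\}$. A seaweed in $\mathfrak g$ is an intersection $\mathfrak p_1\cap\mathfrak p_2$ of two parabolic subalgebras with $\mathfrak p_1+\mathfrak p_2=\mathfrak g$. The direct sum and the semi-direct product are formed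 with the bracket of $\widehat{\mathfrak g}$ (so $\mathfrak zt^{-1}=\mathfrak z\otimes t^{-1}\subset\mathfrak g[t,t^{-1}]$). *)

(* Defs.v *)
From HB Require Import structures.
From mathcomp Require Import all_boot all_order all_algebra finmap.
From mathcomp Require Import boolp classical_sets functions.

Set Implicit Arguments.
Unset Strict Implicit.
Unset Printing Implicit Defensive.

Import GRing.Theory.

Local Open Scope classical_set_scope.
Local Open Scope ring_scope.

HB.mixin Record isLieAlgebra (R : comNzRingType) V of GRing.Lmodule R V := {
  bracket : V -> V -> V;
  bracket_linearl : forall y, linear (bracket^~ y);
  bracket_linearr : forall x, linear (bracket x);
  bracket_alt : forall x, bracket x x = 0;
  bracket_jacobi : forall x y z,
    bracket x (bracket y z) + bracket y (bracket z x)
    + bracket z (bracket x y) = 0 }.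

#[short(type="lieAlgType")]
HB.structure Definition LieAlgebra (R : comNzRingType) :=
  { V of isLieAlgebra R V & GRing.Lmodule R V }.

Notation "[ 'lie' x , y ]" := (bracket x y)
  (at level 0, x, y at level 99, format "[ 'lie'  x ,  y ]") : ring_scope.

Section LieSets.
Context {k : fieldType} {L : lieAlgType k}.
Implicit Types A B I P : set L.

Definition is_subspace A :=
  A 0 /\ forall (a : k) x y, A x -> A y -> A (a *: x + y).

Definition span A : set L := smallest is_subspace A.

Definition is_subalgebra A :=
  is_subspace A /\ forall x y, A x -> A y -> A [lie x, y].

Definition lie_gen A : set L := smallest is_subalgebra A.

Definition is_ideal I A :=
  [/\ is_subspace I, I `<=` A & forall x y, A x -> I y -> I [lie x, y]].

Definition set_add A B : set L := [set x + y | x in A & y in B].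

Definition set_bracket A B : set L := span [set [lie x, y] | x in A & y in B].

Fixpoint lower_central A n : set L :=
  if n is m.+1 then set_bracket A (lower_central A m) else A.

Fixpoint derived A n : set L :=
  if n is m.+1 then set_bracket (derived A m) (derived A m) else A.

Definition is_nilpotent A := exists n, lower_central A n `<=` [set 0].

Definition is_solvable A := exists n, derived A n `<=` [set 0].

Definition normalizer A : set L := [set x | forall y, A y -> A [lie x, y]].

Definition centre A : set L := [set x | A x /\ forall y, A y -> [lie x, y] = 0].

Definition nilradical A : set L :=
  span (\bigcup_(I in [set I | is_ideal I A /\ is_nilpotent I]) I).

Definition is_cartan A :=
  [/\ is_subalgebra A, is_nilpotent A & normalizer A = A].

Definition is_max_solvable A :=
  [/\ is_subalgebra A, is_solvable A &
      forall B, is_subalgebra B -> is_solvable B -> A `<=` B -> B = A].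

(* The sum [set_add A B] of two subalgebras is their internal direct sum. *)
Definition is_direct A B :=
  [/\ is_subalgebra A, is_subalgebra B, A `&` B = [set 0] &
      forall x y, A x -> B y -> [lie x, y] = 0].

(* The sum [set_add A I] is the internal semi-direct product of the
   subalgebra [A] and the ideal [I]. *)
Definition is_semidirect A I :=
  [/\ is_subalgebra A, is_subalgebra I, A `&` I = [set 0] &
      forall x y, A x -> I y -> I [lie x, y]].

Definition line (x : L) : set L := [set a *: x | a in [set: k]].

End LieSets.

Definition lie_isog (k : fieldType) (L M : lieAlgType k)
    (A : set L) (B : set M) :=
  exists f : L -> M,
    [/\ set_bij A B f,
        forall (a : k) x y, A x -> A y -> f (a *: x + y) = a *: f x + f y &
        forall x y, A x -> A y -> f [lie x, y] = [lie f x, f y]].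

Section SpecialLinear.
Variables (k : fieldType) (r : nat).

Definition traceless : {pred 'M[k]_r.+1} := fun A => \tr A == 0.

Fact traceless_submod : submod_closed traceless.
Proof.
split=> [|a A B /eqP trA /eqP trB]; first by rewrite unfold_in mxtrace0.
by rewrite unfold_in mxtraceD mxtraceZ trA trB mulr0 addr0.
Qed.

HB.instance Definition _ :=
  GRing.isSubmodClosed.Build k 'M[k]_r.+1 traceless traceless_submod.

Record sl := Sl { sl_mx : 'M[k]_r.+1; sl_mxP : sl_mx \in traceless }.

HB.instance Definition _ := [isSub for sl_mx].
HB.instance Definition _ := [Choice of sl by <:].
HB.instance Definition _ := [SubChoice_isSubLmodule of sl by <:].

Fact sl_bracket_subproof (x y : sl) :
  sl_mx x *m sl_mx y - sl_mx y *m sl_mx x \in traceless.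
Proof. by rewrite unfold_in raddfB /= mxtrace_mulC subrr. Qed.

Definition sl_bracket (x y : sl) : sl := Sl (sl_bracket_subproof x y).

Fact sl_bracket_linearl y : linear (sl_bracket^~ y).
Proof.
move=> a x x'; apply: val_inj; rewrite /= mulmxDl mulmxDr.
by rewrite -scalemxAl -scalemxAr scalerBr opprD addrACA.
Qed.

Fact sl_bracket_linearr x : linear (sl_bracket x).
Proof.
move=> a y y'; apply: val_inj; rewrite /= mulmxDl mulmxDr.
by rewrite -scalemxAl -scalemxAr scalerBr opprD addrACA.
Qed.

Fact sl_bracket_alt x : sl_bracket x x = 0.
Proof. by apply: val_inj; rewrite /= subrr. Qed.

Fact sl_bracket_jacobi x y z :
  sl_bracket x (sl_bracket y z) + sl_bracket y (sl_bracket z x)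
  + sl_bracket z (sl_bracket x y) = 0.
Proof.
apply: val_inj => /=; case: x y z => [x _] [y _] [z _] /=.
rewrite !(mulmxBl, mulmxBr) !mulmxA !opprB !addrA.
rewrite [LHS](ACl ((1*12)*(3*10)*(5*4)*(7*2)*(9*8)*(11*6)))/=.
by rewrite !subrr !addr0.
Qed.

HB.instance Definition _ := isLieAlgebra.Build k sl
  sl_bracket_linearl sl_bracket_linearr sl_bracket_alt sl_bracket_jacobi.

(* The normalised invariant form of sl_(r+1): for the trace form the roots
   have square length 2. *)
Definition sl_form (x y : sl) : k := \tr (sl_mx x *m sl_mx y).

End SpecialLinear.

(* Laurent polynomials over [V]: the coefficient of [t^i] in [f] is [f i]. *)
Definition loop (V : zmodType) := {fsfun int -> V with 0}.

HB.instance Definition _ (V : zmodType) := Choice.on (loop V).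

Definition mono (V : zmodType) (i : int) (v : V) : loop V :=
  [fsfun j in [fset i]%fset => v | 0].

Section LoopModule.
Variables (k : fieldType) (V : lmodType k).
Implicit Types f g h : loop V.

Definition loop_add f g : loop V :=
  [fsfun i in (finsupp f `|` finsupp g)%fset => f i + g i | 0].
Definition loop_opp f : loop V := [fsfun i in finsupp f => - f i | 0].
Definition loop_scale (a : k) f : loop V :=
  [fsfun i in finsupp f => a *: f i | 0].
Definition loop_zero : loop V := [fsfun].

Fact loop_addE f g i : loop_add f g i = f i + g i.
Proof.
rewrite fsfunE in_fsetU; case: ifP => // /norP[].
by move=> /fsfun_dflt-> /fsfun_dflt->; rewrite addr0.
Qed.

Fact loop_oppE f i : loop_opp f i = - f i.
Proof. by rewrite fsfunE; case: finsuppP; rewrite ?oppr0. Qed.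

Fact loop_scaleE a f i : loop_scale a f i = a *: f i.
Proof. by rewrite fsfunE; case: finsuppP; rewrite ?scaler0. Qed.

Fact loop_zeroE i : loop_zero i = 0. Proof. by rewrite fsfunE. Qed.

Fact loop_addA : associative loop_add.
Proof. by move=> f g h; apply/fsfunP => i; rewrite !loop_addE addrA. Qed.
Fact loop_addC : commutative loop_add.
Proof. by move=> f g; apply/fsfunP => i; rewrite !loop_addE addrC. Qed.
Fact loop_add0 : left_id loop_zero loop_add.
Proof. by move=> f; apply/fsfunP => i; rewrite loop_addE loop_zeroE add0r. Qed.
Fact loop_addN : left_inverse loop_zero loop_opp loop_add.
Proof.
by move=> f; apply/fsfunP => i; rewrite loop_addE loop_oppE loop_zeroE addNr.
Qed.

HB.instance Definition _ := GRing.isZmodule.Build (loop V)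
  loop_addA loop_addC loop_add0 loop_addN.

Fact loop_scaleA a b f : loop_scale a (loop_scale b f) = loop_scale (a * b) f.
Proof. by apply/fsfunP => i; rewrite !loop_scaleE scalerA. Qed.
Fact loop_scale1 : left_id 1 loop_scale.
Proof. by move=> f; apply/fsfunP => i; rewrite loop_scaleE scale1r. Qed.
Fact loop_scaleDr : right_distributive loop_scale +%R.
Proof.
by move=> a f g; apply/fsfunP=> i; rewrite !(loop_addE, loop_scaleE) scalerDr.
Qed.
Fact loop_scaleDl f : {morph loop_scale^~ f : a b / a + b}.
Proof.
by move=> a b; apply/fsfunP => i; rewrite !(loop_addE, loop_scaleE) scalerDl.
Qed.

HB.instance Definition _ := GRing.Zmodule_isLmodule.Build k (loop V)
  loop_scaleA loop_scale1 loop_scaleDr loop_scaleDl.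

Lemma loopD f g i : (f + g) i = f i + g i. Proof. exact: loop_addE. Qed.
Lemma loopZ a f i : (a *: f) i = a *: f i. Proof. exact: loop_scaleE. Qed.
Lemma loop0 i : (0 : loop V) i = 0. Proof. exact: loop_zeroE. Qed.

Lemma loop_sum (I : Type) (s : seq I) (F : I -> loop V) i :
  (\sum_(j <- s) F j) i = \sum_(j <- s) F j i.
Proof.
by elim/big_rec2: _ => [|j u v _ <-]; rewrite ?loop0 ?loopD.
Qed.

Lemma monoE i (v : V) j : mono i v j = if j == i then v else 0.
Proof. by rewrite fsfunE in_fset1. Qed.

Lemma mono_linear i : linear (@mono V i).
Proof.
move=> a u v; apply/fsfunP => j; rewrite loopD loopZ !monoE.
by case: ifP; rewrite ?scaler0 ?addr0.
Qed.

Lemma mono0 i : mono i (0 : V) = 0.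
Proof. by apply/fsfunP => j; rewrite monoE loop0; case: ifP. Qed.

Lemma loop_monoE f : f = \sum_(i <- finsupp f) mono i (f i).
Proof.
apply/fsfunP => j; rewrite loop_sum.
under eq_bigr do rewrite monoE eq_sym.
rewrite -big_mkcond /=; case: (finsuppP f j) => [nj|].
  rewrite big1_seq // => i /andP[/eqP-> jf].
  by rewrite jf in nj.
by move=> jf; rewrite -big_filter filter_pred1_uniq ?fset_uniq ?big_seq1.
Qed.

(* The linear extension of the map [v t^i |-> F i v]. *)
Definition loop_ext (W : lmodType k) (F : int -> V -> W) f : W :=
  \sum_(i <- finsupp f) F i (f i).

Lemma loop_ext_widen (W : lmodType k) (F : int -> V -> W) f (A : {fset int}) :
  (forall i, linear (F i)) -> (finsupp f `<=` A)%fset ->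
  loop_ext F f = \sum_(i <- A) F i (f i).
Proof.
move=> linF fA; rewrite /loop_ext; apply: big_fset_incl => // i _ ni.
rewrite (fsfun_dflt ni); have := linF i (-1) 0 0.
by rewrite scaler0 addr0 scaleN1r addNr.
Qed.

Lemma loop_ext_linear (W : lmodType k) (F : int -> V -> W) :
  (forall i, linear (F i)) -> linear (loop_ext F).
Proof.
move=> linF a f g.
set A := (finsupp f `|` finsupp g `|` finsupp (a *: f + g)%R)%fset.
have fA : (finsupp f `<=` A)%fset by rewrite /A -fsetUA fsubsetUl.
have gA : (finsupp g `<=` A)%fset.
  by rewrite /A (fsetUC (finsupp f)) -fsetUA fsubsetUl.
have hA : (finsupp (a *: f + g)%R `<=` A)%fset by rewrite /A fsubsetUr.
rewrite (loop_ext_widen linF fA) (loop_ext_widen linF gA).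
rewrite (loop_ext_widen linF hA) scaler_sumr -big_split /=.
by apply: eq_bigr => i _; rewrite loopD loopZ linF.
Qed.

Lemma loop_ext_mono (W : lmodType k) (F : int -> V -> W) i v :
  (forall i, linear (F i)) -> loop_ext F (mono i v) = F i v.
Proof.
move=> linF; rewrite (@loop_ext_widen _ _ _ [fset i]%fset) //.
  by rewrite big_seq_fset1 monoE eqxx.
apply/fsubsetP => j; rewrite mem_finsupp monoE in_fset1.
by case: ifP; rewrite ?eqxx.
Qed.

Lemma loop_ext0 (W : lmodType k) (F : int -> V -> W) : loop_ext F 0 = 0.
Proof. by rewrite /loop_ext finsupp0 big_seq_fset0. Qed.

(* The bilinear extension of the map [(u t^i, v t^j) |-> F i u j v]. *)
Definition loop_ext2 (W : lmodType k) (F : int -> V -> int -> V -> W) f g : W :=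
  loop_ext (fun i u => loop_ext (F i u) g) f.

Section Bilinear.
Variables (W : lmodType k) (F : int -> V -> int -> V -> W).
Hypothesis linFl : forall i j v, linear (fun u => F i u j v).
Hypothesis linFr : forall i u j, linear (F i u j).

Let linl g i : linear (fun u => loop_ext (F i u) g).
Proof.
move=> a u u'; rewrite /loop_ext scaler_sumr -big_split /=.
by apply: eq_bigr => j _; rewrite linFl.
Qed.

Lemma loop_ext2_linearl g : linear (fun f => loop_ext2 F f g).
Proof. exact: loop_ext_linear (linl g). Qed.

Lemma loop_ext2_linearr f : linear (loop_ext2 F f).
Proof.
move=> a u u'; rewrite /loop_ext2 {1 3 5}/loop_ext scaler_sumr -big_split /=.
by apply: eq_bigr => i _; rewrite loop_ext_linear.
Qed.

Lemma loop_ext2_mono i u j v : loop_ext2 F (mono i u) (mono j v) = F i u j v.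
Proof. by rewrite /loop_ext2 loop_ext_mono ?loop_ext_mono. Qed.

Lemma loop_ext20l g : loop_ext2 F 0 g = 0. Proof. exact: loop_ext0. Qed.

Lemma loop_ext20r f : loop_ext2 F f 0 = 0.
Proof.
by rewrite /loop_ext2 {1}/loop_ext; apply: big1 => i _; rewrite loop_ext0.
Qed.

End Bilinear.

End LoopModule.

(* The affine Kac-Moody algebra: [Affine f a b] stands for [f + a C + b d]. *)

Section Affine.
Variables (k : fieldType) (r : nat).
Local Notation g := (sl k r).

Record affine := Affine { aff_loop : loop g; aff_c : k; aff_dd : k }.

Definition aff_tuple x : loop g * k * k := (aff_loop x, aff_c x, aff_dd x).
Definition tuple_aff (p : loop g * k * k) := Affine p.1.1 p.1.2 p.2.
Fact aff_tupleK : cancel aff_tuple tuple_aff. Proof. by case. Qed.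

HB.instance Definition _ := Choice.copy affine (can_type aff_tupleK).

Definition aff_add x y :=
  Affine (aff_loop x + aff_loop y) (aff_c x + aff_c y) (aff_dd x + aff_dd y).
Definition aff_opp x := Affine (- aff_loop x) (- aff_c x) (- aff_dd x).
Definition aff_scale (a : k) x :=
  Affine (a *: aff_loop x) (a * aff_c x) (a * aff_dd x).
Definition aff_zero := Affine 0 0 0.

Fact aff_addA : associative aff_add.
Proof. by move=> x y z; congr Affine; rewrite /= addrA. Qed.
Fact aff_addC : commutative aff_add.
Proof. by move=> x y; congr Affine; rewrite /= addrC. Qed.
Fact aff_add0 : left_id aff_zero aff_add.
Proof. by case=> f a b; congr Affine; rewrite /= add0r. Qed.
Fact aff_addN : left_inverse aff_zero aff_opp aff_add.
Proof. by move=> x; congr Affine; rewrite /= addNr. Qed.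

HB.instance Definition _ :=
  GRing.isZmodule.Build affine aff_addA aff_addC aff_add0 aff_addN.

Fact aff_scaleA a b x : aff_scale a (aff_scale b x) = aff_scale (a * b) x.
Proof. by congr Affine; rewrite /= ?scalerA ?mulrA. Qed.
Fact aff_scale1 : left_id 1 aff_scale.
Proof. by case=> f a b; congr Affine; rewrite /= ?scale1r ?mul1r. Qed.
Fact aff_scaleDr : right_distributive aff_scale +%R.
Proof. by move=> a x y; congr Affine; rewrite /= ?scalerDr ?mulrDr. Qed.
Fact aff_scaleDl x : {morph aff_scale^~ x : a b / a + b}.
Proof. by move=> a b; congr Affine; rewrite /= ?scalerDl ?mulrDl. Qed.

HB.instance Definition _ := GRing.Zmodule_isLmodule.Build k affine
  aff_scaleA aff_scale1 aff_scaleDr aff_scaleDl.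

Definition aff_t (i : int) (x : g) := Affine (mono i x) 0 0.
Definition aff_C := Affine 0 1 0.
Definition aff_d := Affine 0 0 1.

Definition loop_bracket : loop g -> loop g -> loop g :=
  loop_ext2 (fun i x j y => mono (i + j) [lie x, y]).

Definition loop_cocycle : loop g -> loop g -> k^o :=
  loop_ext2 (W := k^o) (fun i x j y => (i == - j)%:R * i%:~R * sl_form x y).

Definition loop_deriv : loop g -> loop g :=
  loop_ext (fun i x => i%:~R *: mono i x).

Definition aff_bracket (x y : affine) : affine :=
  Affine (loop_bracket (aff_loop x) (aff_loop y)
          + aff_dd x *: loop_deriv (aff_loop y)
          - aff_dd y *: loop_deriv (aff_loop x))
         (loop_cocycle (aff_loop x) (aff_loop y))
         0.

Lemma sl_form_linearl y : linear ((@sl_form k r)^~ y : g -> k^o).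
Proof.
by move=> a x x'; rewrite /sl_form /= mulmxDl mxtraceD -scalemxAl mxtraceZ.
Qed.

Lemma sl_formC x y : @sl_form k r x y = sl_form y x.
Proof. by rewrite /sl_form mxtrace_mulC. Qed.

Lemma sl_form_linearr x : linear (@sl_form k r x : g -> k^o).
Proof. by move=> a y y'; rewrite !(sl_formC x) sl_form_linearl. Qed.

Let bl i j y : linear (fun x : g => mono (i + j) [lie x, y]).
Proof. by move=> a x x'; rewrite bracket_linearl mono_linear. Qed.

Let br i x j : linear (fun y : g => mono (i + j) [lie x, y]).
Proof. by move=> a y y'; rewrite bracket_linearr mono_linear. Qed.

Let cl i j y :
  linear (fun x : g => (i == - j)%:R * i%:~R * sl_form x y : k^o).
Proof. by move=> a x x'; rewrite sl_form_linearl mulrDr mulrCA. Qed.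

Let cr i x j :
  linear (fun y : g => (i == - j)%:R * i%:~R * sl_form x y : k^o).
Proof. by move=> a y y'; rewrite sl_form_linearr mulrDr mulrCA. Qed.

Let dl i : linear (fun x : g => i%:~R *: mono i x : loop g).
Proof. by move=> a x y; rewrite mono_linear scalerDr !scalerA mulrC. Qed.

Let comb3l (W : lmodType k) a b b' c (s s' p q q' : W) :
  (a *: s + s') + (a * b + b') *: p - c *: (a *: q + q')
  = a *: (s + b *: p - c *: q) + (s' + b' *: p - c *: q').
Proof.
rewrite !scalerDr scalerN scalerDl opprD !scalerA [a * c]mulrC !addrA.
by rewrite [LHS](ACl (1*3*5*2*4*6)).
Qed.

Let comb3r (W : lmodType k) a b c c' (s s' p p' q : W) :
  (a *: s + s') + b *: (a *: p + p') - (a * c + c') *: q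
  = a *: (s + b *: p - c *: q) + (s' + b *: p' - c' *: q).
Proof.
rewrite !scalerDr scalerN scalerDl opprD !scalerA [a * b]mulrC !addrA.
by rewrite [LHS](ACl (1*3*5*2*4*6)).
Qed.

Fact aff_bracket_linearl y : linear (aff_bracket^~ y).
Proof.
move=> a x x'; congr Affine => /=; last by rewrite mulr0 addr0.
  rewrite /loop_bracket /loop_deriv loop_ext2_linearl // loop_ext_linear //; exact: comb3l.
by rewrite /loop_cocycle loop_ext2_linearl.
Qed.

Fact aff_bracket_linearr x : linear (aff_bracket x).
Proof.
move=> a y y'; congr Affine => /=; last by rewrite mulr0 addr0.
  rewrite /loop_bracket /loop_deriv loop_ext2_linearr // loop_ext_linear //.
  exact: comb3r.
by rewrite /loop_cocycle loop_ext2_linearr.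
Qed.

Definition aff_bracket_mono (i : int) (x : g) (j : int) (y : g) : affine :=
  aff_t (i + j) [lie x, y]
  + ((i == - j)%:R * i%:~R * sl_form x y) *: aff_C.

Lemma aff_t_linear i : linear (aff_t i).
Proof.
by move=> a x y; congr Affine; rewrite /= ?mono_linear // ?mulr0 addr0.
Qed.

Lemma scale_affC (a : k) : a *: aff_C = Affine 0 a 0.
Proof. by congr Affine; rewrite /= ?scaler0 ?mulr0 ?mulr1. Qed.

Lemma aff_ind (P : affine -> Prop) :
  (forall a x y, P x -> P y -> P (a *: x + y)) ->
  (forall i x, P (aff_t i x)) -> P aff_C -> P aff_d -> forall x, P x.
Proof.
move=> Plin Pt PC Pd [f a b].
have P0 : P 0 by have := Plin (-1) _ _ PC PC; rewrite scaleN1r addNr.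
have -> : Affine f a b = a *: aff_C + (b *: aff_d + Affine f 0 0).
  by congr Affine; rewrite /= ?scaler0 ?mulr1 ?mulr0 ?addr0 ?add0r ?addr0.
do 2!apply: (Plin) => //.
have -> : Affine f 0 0 = \sum_(i <- finsupp f) aff_t i (f i).
  rewrite {1}(loop_monoE f); elim/big_rec2: _ => [//|i u v _ <-].
  by congr Affine; rewrite /= addr0.
elim/big_rec: _ => // i u _ Pu.
by rewrite -[aff_t _ _]scale1r; apply: Plin.
Qed.

Lemma aff_bracket_tt i x j y :
  aff_bracket (aff_t i x) (aff_t j y) = aff_bracket_mono i x j y.
Proof.
rewrite /aff_bracket_mono scale_affC; congr Affine; rewrite /= ?addr0 //.
  by rewrite !scale0r subr0 addr0 /loop_bracket loop_ext2_mono.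
by rewrite add0r /loop_cocycle loop_ext2_mono.
Qed.

Lemma aff_bracketCl y : aff_bracket aff_C y = 0.
Proof.
congr Affine; rewrite /=.
  by rewrite /loop_bracket /loop_deriv loop_ext20l loop_ext0 scale0r scaler0
    subr0 addr0.
by rewrite /loop_cocycle loop_ext20l.
Qed.

Lemma aff_bracketCr y : aff_bracket y aff_C = 0.
Proof.
congr Affine; rewrite /=.
  by rewrite /loop_bracket /loop_deriv loop_ext20r loop_ext0 scale0r scaler0
    subr0 addr0.
by rewrite /loop_cocycle loop_ext20r.
Qed.

Lemma aff_bracket_dt i x : aff_bracket aff_d (aff_t i x) = i%:~R *: aff_t i x.
Proof.
congr Affine; rewrite /= ?mulr0 //.
  rewrite /loop_bracket /loop_deriv loop_ext20l scale0r scale1r subr0 add0r.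
  by rewrite loop_ext_mono.
by rewrite /loop_cocycle loop_ext20l.
Qed.

Lemma aff_bracket_td i x :
  aff_bracket (aff_t i x) aff_d = - (i%:~R *: aff_t i x).
Proof.
congr Affine; rewrite /= ?mulr0 ?oppr0 //.
  rewrite /loop_bracket /loop_deriv loop_ext20r scale0r scale1r addr0 add0r.
  by rewrite loop_ext_mono.
by rewrite /loop_cocycle loop_ext20r.
Qed.

Lemma aff_bracket_dd : aff_bracket aff_d aff_d = 0.
Proof.
congr Affine; rewrite /=; last by rewrite /loop_cocycle loop_ext20l.
by rewrite /loop_bracket loop_ext20l add0r subrr.
Qed.

Lemma aff_bracket0l y : aff_bracket 0 y = 0.
Proof.
by have := aff_bracket_linearl y (-1) 0 0; rewrite scaler0 addr0 scaleN1r addNr.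
Qed.

Lemma aff_bracket0r x : aff_bracket x 0 = 0.
Proof.
by have := aff_bracket_linearr x (-1) 0 0; rewrite scaler0 addr0 scaleN1r addNr.
Qed.

Lemma aff_bracketZr x a y : aff_bracket x (a *: y) = a *: aff_bracket x y.
Proof.
by have := aff_bracket_linearr x a y 0; rewrite aff_bracket0r !addr0.
Qed.

Lemma aff_bracketZl y a x : aff_bracket (a *: x) y = a *: aff_bracket x y.
Proof.
by have := aff_bracket_linearl y a x 0; rewrite aff_bracket0l !addr0.
Qed.

Lemma aff_bracketDr x y z :
  aff_bracket x (y + z) = aff_bracket x y + aff_bracket x z.
Proof. by have := aff_bracket_linearr x 1 y z; rewrite !scale1r. Qed.

Lemma lie_anticomm (L : lieAlgType k) (x y : L) : [lie x, y] = - [lie y, x].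
Proof.
have linl z : {morph bracket^~ z : u v / u + v}.
  by move=> u v; have := bracket_linearl z 1 u v; rewrite !scale1r.
have linr z : {morph bracket z : u v / u + v}.
  by move=> u v; have := bracket_linearr z 1 u v; rewrite !scale1r.
apply/eqP; rewrite -addr_eq0; have := bracket_alt (x + y).
by rewrite linl !linr !bracket_alt add0r addr0 => ->.
Qed.

Lemma aff_tZ i a x : aff_t i (a *: x) = a *: aff_t i x.
Proof.
by have := aff_t_linear i a x 0; rewrite addr0 => ->; rewrite /aff_t mono0 addr0.
Qed.

Lemma aff_tD i x y : aff_t i (x + y) = aff_t i x + aff_t i y.
Proof. by have := aff_t_linear i 1 x y; rewrite !scale1r. Qed.

Lemma aff_mono_anticomm i x j y :
  aff_bracket_mono i x j y = - aff_bracket_mono j y i x.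
Proof.
rewrite /aff_bracket_mono lie_anticomm sl_formC -scaleN1r aff_tZ scaleN1r.
rewrite (addrC j) opprD -scaleNr; case: (eqVneq i (- j)) => [->|ij].
  by rewrite opprK eqxx !mul1r mulrNz mulNr.
have /negPf-> : j != - i by rewrite -eqr_oppLR eq_sym.
by rewrite !mul0r oppr0.
Qed.

Let comb_opp (W : lmodType k) a (u u' v v' : W) :
  u = - v -> u' = - v' -> a *: u + u' = - (a *: v + v').
Proof. by move=> -> ->; rewrite scalerN opprD. Qed.

Lemma aff_bracket_anticomm x y : aff_bracket x y = - aff_bracket y x.
Proof.
elim/aff_ind: x y => [a x x' IHx IHx' y|i x y| |].
- by rewrite aff_bracket_linearl aff_bracket_linearr; apply: comb_opp.
- elim/aff_ind: y => [a y y' IHy IHy'|j y| |].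
  + exact: (etrans (aff_bracket_linearr _ a y y') (etrans (comb_opp a IHy IHy')
      (congr1 -%R (esym (aff_bracket_linearl _ a y y'))))).
  + by rewrite !aff_bracket_tt aff_mono_anticomm.
  + by rewrite aff_bracketCl aff_bracketCr oppr0.
  + by rewrite aff_bracket_dt aff_bracket_td.
- by move=> y; rewrite aff_bracketCl aff_bracketCr oppr0.
- elim/aff_ind => [a y y' IHy IHy'|j y| |].
  + exact: (etrans (aff_bracket_linearr _ a y y') (etrans (comb_opp a IHy IHy')
      (congr1 -%R (esym (aff_bracket_linearl _ a y y'))))).
  + by rewrite aff_bracket_dt aff_bracket_td opprK.
  + by rewrite aff_bracketCl aff_bracketCr oppr0.
  + by rewrite aff_bracket_dd oppr0.
Qed.

Let comb_alt (W : lmodType k) (a : k) (u v : W) :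
  u = - v -> a *: (a *: 0 + u) + (a *: v + 0) = 0.
Proof. by move=> ->; rewrite scaler0 add0r addr0 scalerN addNr. Qed.

Fact aff_bracket_alt x : aff_bracket x x = 0.
Proof.
elim/aff_ind: x => [a x y IHx IHy|i x| |].
- rewrite aff_bracket_linearl !aff_bracket_linearr IHx IHy.
  exact/comb_alt/aff_bracket_anticomm.
- rewrite aff_bracket_tt /aff_bracket_mono bracket_alt.
  rewrite /aff_t mono0 add0r; case: eqP => [/eqP|_]; last by rewrite !mul0r scale0r.
  rewrite -addr_eq0 => /eqP ii; suff -> : i = 0 by rewrite mulr0 mul0r scale0r.
  by case: i ii => [[]|] //.
- exact: aff_bracketCl.
- exact: aff_bracket_dd.
Qed.

Definition aff_jac x y z :=
  aff_bracket x (aff_bracket y z) + aff_bracket y (aff_bracket z x)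
  + aff_bracket z (aff_bracket x y).

Let sum3_rot (W : zmodType) (a b c : W) : a + b + c = b + c + a.
Proof. by rewrite [RHS]addrC addrA. Qed.

Let sum3_lin (W : lmodType k) a (u u' v v' w w' : W) :
  (a *: u + u') + (a *: v + v') + (a *: w + w')
  = a *: (u + v + w) + (u' + v' + w').
Proof. by rewrite !scalerDr !addrA [LHS](ACl (1*3*5*2*4*6)). Qed.

Lemma aff_jac_rot x y z : aff_jac x y z = aff_jac y z x.
Proof. exact: sum3_rot. Qed.

Lemma aff_jac_linear y z a x x' :
  aff_jac (a *: x + x') y z = a *: aff_jac x y z + aff_jac x' y z.
Proof.
rewrite /aff_jac (aff_bracket_linearl y) (aff_bracket_linearr z).
rewrite (aff_bracket_linearl (aff_bracket y z)).
rewrite (aff_bracket_linearr y) (aff_bracket_linearr z); exact: sum3_lin.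
Qed.

Lemma aff_jac_Clr y z : aff_jac aff_C y z = 0.
Proof.
by rewrite /aff_jac aff_bracketCr !aff_bracketCl !aff_bracket0r !addr0.
Qed.

Let sum3_alt (W : zmodType) (a b c : W) : a = - b -> c = 0 -> a + b + c = 0.
Proof. by move=> -> ->; rewrite addNr addr0. Qed.

Lemma aff_jac_dd z : aff_jac aff_d aff_d z = 0.
Proof.
apply: sum3_alt; last by rewrite aff_bracket_dd aff_bracket0r.
by rewrite (aff_bracket_anticomm z) -!scaleN1r aff_bracketZr scalerA mulrNN
  mulr1 scale1r.
Qed.

Lemma aff_bracketDl x y z :
  aff_bracket (y + z) x = aff_bracket y x + aff_bracket z x.
Proof. by have := aff_bracket_linearl x 1 y z; rewrite !scale1r. Qed.

Lemma aff_jac_dtt i x j y : aff_jac aff_d (aff_t i x) (aff_t j y) = 0.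
Proof.
rewrite /aff_jac aff_bracket_td aff_bracket_dt -scaleN1r !aff_bracketZr.
rewrite [aff_bracket (aff_t j y) _]aff_bracket_anticomm !aff_bracket_tt.
rewrite {1}/aff_bracket_mono aff_bracketDr aff_bracketZr aff_bracketCr.
rewrite aff_bracket_dt scaler0 addr0 scaleN1r /aff_bracket_mono.
rewrite !scalerN !scalerDr -addrA -opprD addrACA -!scalerDl -intrD addrC.
rewrite scalerA (addrC j); case: eqP => [->|_].
  by rewrite addNr !mul0r !scale0r !addr0 oppr0.
by rewrite !mul0r mulr0 scale0r addr0 addNr.
Qed.

Lemma sl_form_invariant (x y z : g) : sl_form [lie x, y] z = sl_form x [lie y, z].
Proof.
rewrite /sl_form /= mulmxBl mulmxBr !raddfB /= !mulmxA; congr (_ - _).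
by rewrite mxtrace_mulC !mulmxA mxtrace_mulC !mulmxA.
Qed.

Let sum3_pair (W : lmodType k) (u v w p : W) (a b c : k) :
  u + v + w = 0 -> a + b + c = 0 ->
  (u + a *: p) + (v + b *: p) + (w + c *: p) = 0.
Proof.
move=> uvw abc; rewrite !addrA [LHS](ACl ((1*3*5)*(2*4*6))) /= uvw add0r.
by rewrite -!scalerDl abc scale0r.
Qed.

Lemma aff_jac_ttt i x j y l z :
  aff_jac (aff_t i x) (aff_t j y) (aff_t l z) = 0.
Proof.
rewrite /aff_jac !aff_bracket_tt.
have E m u n v p w : aff_bracket (aff_t m u) (aff_bracket_mono n v p w)
    = aff_bracket_mono m u (n + p) [lie v, w].
  by rewrite {1}/aff_bracket_mono aff_bracketDr aff_bracketZr aff_bracketCr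
    scaler0 addr0 aff_bracket_tt.
rewrite !E /aff_bracket_mono.
have -> : j + (l + i) = i + (j + l) by rewrite addrA addrC.
have -> : l + (i + j) = i + (j + l) by rewrite addrC -addrA.
have fE2 : sl_form y [lie z, x] = sl_form x [lie y, z].
  by rewrite -sl_form_invariant sl_formC.
have fE3 : sl_form z [lie x, y] = sl_form x [lie y, z].
  by rewrite sl_formC sl_form_invariant.
apply: sum3_pair; first by rewrite -!aff_tD bracket_jacobi /aff_t mono0.
rewrite fE2 fE3 -!mulrDl.
have e2 : (j == - (l + i)) = (i == - (j + l)).
  by rewrite -!addr_eq0; congr (_ == 0); rewrite addrA addrC.
have e3 : (l == - (i + j)) = (i == - (j + l)).
  by rewrite -!addr_eq0; congr (_ == 0); rewrite addrC -addrA.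
rewrite e2 e3; case: eqP => [->|_]; last by rewrite !mul0r !add0r mul0r.
by rewrite !mul1r -!intrD -addrA addNr mul0r.
Qed.

Lemma aff_jac_ind y z : (forall i x, aff_jac (aff_t i x) y z = 0) ->
  aff_jac aff_d y z = 0 -> forall x, aff_jac x y z = 0.
Proof.
move=> Jt Jd x.
refine (aff_ind (P := fun x => aff_jac x y z = 0) _ Jt (aff_jac_Clr y z) Jd x).
by move=> a u v Ju Jv; rewrite aff_jac_linear Ju Jv scaler0 addr0.
Qed.

Fact aff_bracket_jacobi x y z : aff_jac x y z = 0.
Proof.
have Jd u v : aff_jac aff_d u v = 0.
  rewrite aff_jac_rot; refine (aff_jac_ind _ _ u) => [i u'|].
    rewrite aff_jac_rot; refine (aff_jac_ind _ _ v) => [j v'|].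
      by rewrite aff_jac_rot aff_jac_dtt.
    exact: aff_jac_dd.
  by rewrite -aff_jac_rot aff_jac_dd.
refine (aff_jac_ind _ (Jd y z) x) => i x'; rewrite aff_jac_rot.
refine (aff_jac_ind _ (Jd _ _) y) => j y'; rewrite aff_jac_rot.
refine (aff_jac_ind _ (Jd _ _) z) => l z'; exact: aff_jac_ttt.
Qed.

HB.instance Definition _ := isLieAlgebra.Build k affine
  aff_bracket_linearl aff_bracket_linearr aff_bracket_alt aff_bracket_jacobi.

End Affine.

Section Roots.
Context {k : fieldType} {r : nat}.
Local Notation g := (sl k r).
Implicit Types t b p q : set g.

(* Over a field that need not be algebraically closed, roots exist only for a
   split Cartan subalgebra: all its elements are diagonalisable over [k]. *)
Definition is_split_cartan t :=
  is_cartan t /\ forall x, t x -> diagonalizable (sl_mx x).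

(* Over such a field a maximal solvable subalgebra is a Borel subalgebra as
   soon as it contains a split Cartan subalgebra. *)
Definition is_borel_pair t b :=
  [/\ is_split_cartan t, is_max_solvable b & t `<=` b].

Definition is_parabolic p :=
  is_subalgebra p /\ exists t b, is_borel_pair t b /\ b `<=` p.

Definition is_seaweed q :=
  exists p1 p2, [/\ is_parabolic p1, is_parabolic p2,
                    set_add p1 p2 = [set: g] & q = p1 `&` p2].

Definition root_space t (a : t -> k) : set g :=
  [set x | forall h : t, [lie \val h, x] = a h *: x].

Definition is_root t (a : t -> k) :=
  (exists h, a h != 0) /\ exists2 x, root_space a x & x != 0.

Definition is_positive t b (a : t -> k) := is_root a /\ root_space a `<=` b.

Definition is_simple t b (a : t -> k) :=
  is_positive b a /\
  ~ exists a1 a2 : t -> k,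
      [/\ is_positive b a1, is_positive b a2 & a = a1 \+ a2].

Definition is_highest t b (a : t -> k) :=
  is_positive b a /\
  forall a' : t -> k, is_positive b a' -> ~ is_root (a \+ a').

Definition root_vectors t (e : (t -> k) -> g) :=
  forall a, is_root a -> root_space a (e a) /\ e a != 0.

End Roots.

Section AffineParabolics.
Context {k : fieldType} {r : nat}.
Local Notation g := (sl k r).
Variables (t b : set g) (lambda : t -> k) (e : (t -> k) -> g).

(* [(a, m)] stands for the linear form [a + m delta] on [t + k C + k d], whose
   restriction to [t] is [a] and which maps [C] to 0 and [d] to [m]. *)
Definition aff_weight := ((t -> k) * int)%type.
Implicit Types S : set aff_weight.

Definition simple_roots : set aff_weight :=
  [set (a, 0) | a in [set a : t -> k | is_simple b a]].

Definition alpha0 : aff_weight := (\- lambda, 1).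

Definition aff_simple_roots : set aff_weight :=
  simple_roots `|` [set alpha0].

(* For [w = alpha0] this is [e lambda * t^-1]. *)
Definition aff_neg_vector (w : aff_weight) : affine k r :=
  aff_t (- w.2) (e (\- w.1)).

Definition aff_cartan : set (affine k r) :=
  set_add (set_add (aff_t 0 @` t) (line (aff_C k r))) (line (aff_d k r)).

Definition aff_positive_part : set (affine k r) :=
  [set x | [/\ aff_c x = 0, aff_dd x = 0 &
               forall i : int, (i <= 0)%R -> aff_loop x i = 0]].

Definition aff_borel : set (affine k r) :=
  set_add (set_add (aff_t 0 @` b) aff_cartan) aff_positive_part.

Definition aff_parabolic S : set (affine k r) :=
  lie_gen (aff_borel `|` aff_neg_vector @` S).

Definition is_omega (omega : affine k r -> affine k r) :=
  [/\ linear omega,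
      {morph omega : x y / [lie x, y]},
      involutive omega,
      (forall x, aff_cartan x -> omega x = - x) &
      forall i : int, omega @` (aff_t i @` [set: g]) = aff_t (- i) @` [set: g]].

Definition aff_seaweed omega S S' : set (affine k r) :=
  aff_parabolic S `&` omega @` aff_parabolic S'.

Definition parabolic S : set g :=
  lie_gen (b `|` [set e (\- w.1) | w in S]).

(* [omega b], seen in the degree zero part [g] of the affine algebra. *)
Definition opposite_borel (omega : affine k r -> affine k r) : set g :=
  aff_t 0 @^-1` (omega @` (aff_t 0 @` b)).

Definition opposite_parabolic omega S : set g :=
  lie_gen (opposite_borel omega `|` [set e w.1 | w in S]).

End AffineParabolics.

(* Main.v *)
Require Import Defs.
From mathcomp Require Import all_boot all_order all_algebra finmap.
From mathcomp Require Import fingroup perm.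
From mathcomp Require Import boolp classical_sets functions.
From mathcomp Require Import zify ring.
Import GRing.Theory.
Local Open Scope classical_set_scope.
Local Open Scope ring_scope.

Set Implicit Arguments.
Unset Strict Implicit.
Unset Printing Implicit Defensive.

(** The elements of a split Cartan subalgebra commute and are diagonalisable,
    hence are diagonal in a common basis; ordering that basis suitably, the Borel
    subalgebra becomes upper triangular ([borel_pair_adapted]).  In this basis each
    subalgebra involved is the set of matrices with a prescribed support, which
    turns the inclusions to be proved into inequalities between indices.  Let
    [beta i] be the number of simple roots outside [S] among the first [i] ones,
    so that the fibres of [beta] are the diagonal blocks.  Then the finite
    parabolic is [beta i <= beta j], its nilradical is [beta i < beta j]
    ([nilradical_par]), and the centre of that nilradical is the corner block,
    whose rows lie in the first diagonal block and whose columns lie in the last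
    one ([centre_par_nil]).

    The involution reverses degrees and maps [E_ij] to a multiple of [E_ji]
    ([sigma_elt]).  As [S'] consists of finite simple roots, its affine parabolic
    lives in degrees at least 0, so the image of that parabolic under the
    involution lives in degrees at most 0, with the opposite parabolic as degree
    zero part ([omega_graded_par]).  Intersecting with it therefore keeps only
    the nonpositive degrees of the affine parabolic of [S].

    If [alpha0] is not in [S], that parabolic has no negative degrees
    ([aff_parabolic_finite]) and only the finite seaweed, [d] and [C] remain.
    If [alpha0] is in [S], some finite simple root is missing from [S], so there
    are at least two diagonal blocks.  Under the finite parabolic the vector
    [e_lambda t^-1] then generates exactly the corner block times [t^-1]; the
    corner block has zero bracket with itself, so degree -2 is empty, and its
    bracket with all of [g] stays in the finite parabolic, so degree 0 does not
    grow ([aff_parabolic_affine]).  In both cases the isomorphism is the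
    identity. *)

(** * Subspaces and subalgebras of a Lie algebra *)

Section LieSubspaces.
Context {k : fieldType} {L : lieAlgType k}.
Implicit Types A B V : set L.

Lemma is_subspaceZ V a x : is_subspace V -> V x -> V (a *: x).
Proof. by case=> V0 VL Vx; rewrite -[_ *: _]addr0; apply: VL. Qed.

Lemma is_subspaceD V x y : is_subspace V -> V x -> V y -> V (x + y).
Proof. by case=> V0 VL Vx Vy; rewrite -[x]scale1r; apply: VL. Qed.

Lemma is_subspaceN V x : is_subspace V -> V x -> V (- x).
Proof. by move=> sV Vx; rewrite -scaleN1r; apply: is_subspaceZ. Qed.

Lemma is_subspaceB V x y : is_subspace V -> V x -> V y -> V (x - y).
Proof. by move=> sV Vx Vy; apply: is_subspaceD => //; apply: is_subspaceN. Qed.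

Lemma is_subspace_sum V (I : Type) (s : seq I) (Q : pred I) (F : I -> L) :
  is_subspace V -> (forall i, Q i -> V (F i)) -> V (\sum_(i <- s | Q i) F i).
Proof.
move=> sV VF; elim/big_rec: _ => [|i x Qi Vx]; first by case: sV.
by apply: is_subspaceD => //; apply: VF.
Qed.

Lemma is_subspaceVZ V a x : is_subspace V -> a != 0 -> V (a *: x) -> V x.
Proof.
by move=> sV a0 Vx; rewrite -[x](scalerK a0); apply: is_subspaceZ.
Qed.

Lemma span_subspace A : is_subspace (Defs.span A).
Proof.
split=> [V [[V0 _] _] //|a x y Ax Ay V VP].
by case: (VP) => -[_ VL] _; apply: VL; [exact: Ax|exact: Ay].
Qed.

Lemma sub_span A : A `<=` Defs.span A. Proof. by move=> x Ax V [_]; apply. Qed.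

Lemma span_sub A V : is_subspace V -> A `<=` V -> Defs.span A `<=` V.
Proof. by move=> sV AV x; apply. Qed.

Lemma lie_gen_subalgebra A : is_subalgebra (lie_gen A).
Proof.
split; first split=> [V [[[]]] //|a x y Ax Ay V VP].
  by case: (VP) => -[[_ VL] _] _; apply: VL; [exact: Ax|exact: Ay].
move=> x y Ax Ay V VP.
by case: (VP) => -[_ VL] _; apply: VL; [exact: Ax|exact: Ay].
Qed.

Lemma sub_lie_gen A : A `<=` lie_gen A. Proof. by move=> x Ax V [_]; apply. Qed.

Lemma lie_gen_sub A V : is_subalgebra V -> A `<=` V -> lie_gen A `<=` V.
Proof. by move=> sV AV x; apply. Qed.

Lemma lieDl (x y z : L) : [lie x + y, z] = [lie x, z] + [lie y, z].
Proof. by have := bracket_linearl z 1 x y; rewrite !scale1r. Qed.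

Lemma lieDr (x y z : L) : [lie x, y + z] = [lie x, y] + [lie x, z].
Proof. by have := bracket_linearr x 1 y z; rewrite !scale1r. Qed.

Lemma lie0l (x : L) : [lie 0, x] = 0.
Proof.
by have := bracket_linearl x (-1) 0 0; rewrite scaler0 addr0 scaleN1r addNr.
Qed.

Lemma lie0r (x : L) : [lie x, 0] = 0.
Proof.
by have := bracket_linearr x (-1) 0 0; rewrite scaler0 addr0 scaleN1r addNr.
Qed.

Lemma lieZl a (x y : L) : [lie a *: x, y] = a *: [lie x, y].
Proof. by have := bracket_linearl y a x 0; rewrite !addr0 lie0l addr0. Qed.

Lemma lieZr a (x y : L) : [lie x, a *: y] = a *: [lie x, y].
Proof. by have := bracket_linearr x a y 0; rewrite !addr0 lie0r addr0. Qed.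

Lemma lieNl (x y : L) : [lie - x, y] = - [lie x, y].
Proof. by rewrite -!scaleN1r lieZl. Qed.

Lemma lieNr (x y : L) : [lie x, - y] = - [lie x, y].
Proof. by rewrite -!scaleN1r lieZr. Qed.

Lemma lie_jacobiE (x y z : L) :
  [lie x, [lie y, z]] = [lie [lie x, y], z] + [lie y, [lie x, z]].
Proof.
have := bracket_jacobi x y z.
rewrite (lie_anticomm z x) lieNr (lie_anticomm z [lie x, y]).
by move=> /eqP; rewrite addr_eq0 opprK subr_eq => /eqP.
Qed.

Lemma set_bracket_sub A B V : is_subspace V ->
  (forall x y, A x -> B y -> V [lie x, y]) -> set_bracket A B `<=` V.
Proof. by move=> sV AB; apply: span_sub => // _ [x Ax [y By <-]]; apply: AB. Qed.

Lemma mem_set_bracket A B x y : A x -> B y -> set_bracket A B [lie x, y].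
Proof. by move=> Ax By; apply: sub_span; exists x => //; exists y. Qed.

(** By the Jacobi identity the bracket of two sets inherits their stability
    under [ad a]; this makes the lower central series of an ideal consist of
    ideals. *)
Lemma set_bracket_stable A B (a : L) :
  (forall x, A x -> A [lie a, x]) -> (forall x, B x -> B [lie a, x]) ->
  forall x, set_bracket A B x -> set_bracket A B [lie a, x].
Proof.
move=> aA aB.
suff: set_bracket A B `<=` [set x | set_bracket A B [lie a, x]] by [].
refine (set_bracket_sub _ _).
  have [V0 VL] := span_subspace [set [lie x, y] | x in A & y in B].
  split=> [|c x y Ax Ay] /=; first by rewrite lie0r.
  by rewrite lieDr lieZr; apply: VL.
move=> x y Ax By /=; rewrite lie_jacobiE.
apply: (is_subspaceD (span_subspace _)); apply: mem_set_bracket => //.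
- exact: aA.
- exact: aB.
Qed.

Lemma lower_central_stable A (a : L) n :
  (forall x, A x -> A [lie a, x]) ->
  forall x, lower_central A n x -> lower_central A n [lie a, x].
Proof.
by move=> aA; elim: n => [|n IHn] //=; apply: set_bracket_stable.
Qed.

Lemma lower_central_subspace A n :
  is_subspace A -> is_subspace (lower_central A n).
Proof. by case: n => [|n] // _; apply: span_subspace. Qed.

Lemma line_subspace (x : L) : is_subspace (line x).
Proof.
split; first by exists 0; rewrite ?scale0r.
move=> a _ _ [c _ <-] [d _ <-]; exists (a * c + d) => //.
by rewrite scalerDl scalerA.
Qed.

Lemma line_subalgebra (x : L) : is_subalgebra (line x).
Proof.
split; first exact: line_subspace.
move=> _ _ [c _ <-] [d _ <-]; exists 0 => //.
by rewrite lieZl lieZr bracket_alt !scaler0 scale0r.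
Qed.

Lemma set_addl A B (x : L) : B 0 -> A x -> set_add A B x.
Proof. by move=> B0 Ax; exists x => //; exists 0; rewrite ?addr0. Qed.

Lemma set_addr A B (y : L) : A 0 -> B y -> set_add A B y.
Proof. by move=> A0 By; exists 0 => //; exists y; rewrite ?add0r. Qed.

Lemma line0 (x : L) : line x 0.
Proof. by exists 0; rewrite ?scale0r. Qed.

Lemma line_id (x : L) : line x x.
Proof. by exists 1; rewrite ?scale1r. Qed.

Lemma set_add_subspace A B :
  is_subspace A -> is_subspace B -> is_subspace (set_add A B).
Proof.
move=> sA sB; split; first by apply: set_addl; [case: sB|case: sA].
move=> a _ _ [x Ax [y By <-]] [x' Ax' [y' By' <-]].
exists (a *: x + x'); first by case: sA => _; apply.
exists (a *: y + y'); first by case: sB => _; apply.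
by rewrite scalerDr addrACA.
Qed.

End LieSubspaces.

Lemma lie_isog_refl (k : fieldType) (L : lieAlgType k) (A : set L) :
  lie_isog A A.
Proof.
by exists id; split=> //; split=> // x Ax; exists x.
Qed.

(** * Matrix entries in an adapted basis *)

Section Coordinates.
Context {k : fieldType} {r : nat}.
Local Notation g := (sl k r).
Local Notation I := 'I_r.+1.

Definition mxcoord (P : 'M[k]_r.+1) (x : g) : 'M[k]_r.+1 :=
  P *m sl_mx x *m invmx P.

(** The default value 0 is reached only for matrices of nonzero trace. *)
Definition of_coord (P A : 'M[k]_r.+1) : g := insubd 0 (invmx P *m A *m P).

Definition elt (P : 'M[k]_r.+1) (i j : I) : g := of_coord P (delta_mx i j).

(** A difference of consecutive fundamental coweights, which measures whether a root
    starts or ends at the index [a]; the scalar makes the trace vanish and acts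
    trivially. *)
Definition wt (P : 'M[k]_r.+1) (a : I) : g :=
  of_coord P (delta_mx a a - (r.+1%:R^-1)%:M).

(** Supports of matrices encode all the subalgebras normalised by the diagonal
    one that are used here. *)
Definition coord_supp (P : 'M[k]_r.+1) (R : rel I) : set g :=
  [set x | forall i j, mxcoord P x i j != 0 -> R i j].

Definition upper_rel : rel I := fun i j => (i <= j)%N.
Definition lower_rel : rel I := fun i j => (j <= i)%N.

Variable P : 'M[k]_r.+1.
Hypothesis Pu : P \in unitmx.
Hypothesis chark : [pchar k] =i pred0.
Local Notation m := (mxcoord P).
Local Notation E := (elt P).
Local Notation w := (wt P).
Local Notation supp := (coord_supp P).
Implicit Types (x y : g) (i j l : I) (R : rel I) (V : set g).

Lemma mxcoord_linear a x y : m (a *: x + y) = a *: m x + m y.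
Proof. by rewrite /mxcoord /= mulmxDr mulmxDl -scalemxAr -scalemxAl. Qed.

Lemma mxcoord0 : m 0 = 0.
Proof. by rewrite /mxcoord /= mulmx0 mul0mx. Qed.

Lemma mxcoord0E i j : m 0 i j = 0.
Proof. by rewrite mxcoord0 mxE. Qed.

Lemma mxcoordZ a x : m (a *: x) = a *: m x.
Proof. by rewrite -[a *: x]addr0 mxcoord_linear mxcoord0 addr0. Qed.

Lemma mxcoordD x y : m (x + y) = m x + m y.
Proof. by rewrite -[x]scale1r mxcoord_linear !scale1r. Qed.

Lemma mxcoordN x : m (- x) = - m x.
Proof. by rewrite -!scaleN1r mxcoordZ. Qed.

Lemma mxcoord_sum (J : Type) (s : seq J) (Q : pred J) (F : J -> g) :
  m (\sum_(i <- s | Q i) F i) = \sum_(i <- s | Q i) m (F i).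
Proof. exact: (big_morph m mxcoordD mxcoord0). Qed.

Lemma mxcoordZE a x i j : m (a *: x) i j = a * m x i j.
Proof. by rewrite mxcoordZ mxE. Qed.

Lemma mxcoordDE x y i j : m (x + y) i j = m x i j + m y i j.
Proof. by rewrite mxcoordD mxE. Qed.

Lemma mxcoordNE x i j : m (- x) i j = - m x i j.
Proof. by rewrite mxcoordN mxE. Qed.

Lemma mxcoordBE x y i j : m (x - y) i j = m x i j - m y i j.
Proof. by rewrite mxcoordDE mxcoordNE. Qed.

Lemma mxcoord_sumE (J : Type) (s : seq J) (Q : pred J) (F : J -> g) i j :
  m (\sum_(p <- s | Q p) F p) i j = \sum_(p <- s | Q p) m (F p) i j.
Proof. by rewrite mxcoord_sum summxE. Qed.

Lemma mxcoord_lie x y : m [lie x, y] = m x *m m y - m y *m m x.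
Proof.
by rewrite /mxcoord /= mulmxBr mulmxBl !mulmxA !(mulmxKV Pu).
Qed.

Lemma mxcoord_lieS x y i j : m [lie x, y] i j =
  \sum_l m x i l * m y l j - \sum_l m y i l * m x l j.
Proof. by rewrite mxcoord_lie mxE [X in _ + X]mxE; congr (_ - _); rewrite mxE. Qed.

Lemma mxcoord_inj : injective m.
Proof.
move=> x y /(congr1 (fun A => invmx P *m A *m P)).
rewrite /mxcoord !mulmxA !(mulVmx Pu) !mul1mx !(mulmxKV Pu).
exact: val_inj.
Qed.

Lemma mxcoord_tr x : \tr (m x) = 0.
Proof.
rewrite /mxcoord mxtrace_mulC mulmxA (mulVmx Pu) mul1mx.
by case: x => A /= trA; apply/eqP.
Qed.

Lemma mxcoordK A : \tr A = 0 -> m (of_coord P A) = A.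
Proof.
move=> trA; rewrite /mxcoord /of_coord.
have inA : invmx P *m A *m P \in @traceless k r.
  by rewrite unfold_in mxtrace_mulC mulmxA (mulmxV Pu) mul1mx trA.
have -> : sl_mx (insubd 0 (invmx P *m A *m P)) = invmx P *m A *m P.
  exact: (@insubdK _ _ g 0 _ inA).
by rewrite !mulmxA (mulmxV Pu) mul1mx (mulmxK Pu).
Qed.

Lemma natr_neq0 p : (p != 0)%N -> p%:R != 0 :> k.
Proof. by move=> p0; rewrite ((pcharf0P k).1 chark). Qed.

Lemma mxcoordE i j : i != j -> m (E i j) = delta_mx i j.
Proof.
move=> ij; apply: mxcoordK; rewrite /mxtrace big1 // => l _.
by rewrite mxE; case: eqP => //= ->; rewrite (negPf ij).
Qed.

Lemma mxcoordEE i j a b : i != j -> m (E i j) a b = ((a == i) && (b == j))%:R.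
Proof. by move=> ij; rewrite mxcoordE // mxE. Qed.

Lemma mxcoord_wt a : m (w a) = delta_mx a a - (r.+1%:R^-1)%:M.
Proof.
apply: mxcoordK; rewrite raddfB /= mxtrace_scalar -[_ *+ r.+1]mulr_natr mulVf ?natr_neq0 //.
rewrite /mxtrace (bigD1 a) //= big1 ?addr0 => [|l /negPf la]; rewrite mxE.
  by rewrite !eqxx subrr.
by rewrite la.
Qed.

Lemma mxcoord_wtE a i j :
  m (w a) i j = ((i == a) && (j == a))%:R - (i == j)%:R / r.+1%:R.
Proof. by rewrite mxcoord_wt !mxE mulr_natl. Qed.

Lemma mul_deltaE (A : 'M[k]_r.+1) i j a b :
  (delta_mx i j *m A) a b = (a == i)%:R * A j b.
Proof.
rewrite mxE (bigD1 j) //= big1 ?addr0 => [|l /negPf lj]; rewrite mxE.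
  by rewrite eqxx andbT.
by rewrite lj andbF mul0r.
Qed.

Lemma mulE_delta (A : 'M[k]_r.+1) i j a b :
  (A *m delta_mx i j) a b = A a i * (b == j)%:R.
Proof.
rewrite mxE (bigD1 i) //= big1 ?addr0 => [|l /negPf lj]; rewrite mxE.
  by rewrite eqxx.
by rewrite lj mulr0.
Qed.

Lemma mxcoord_wt_lie a x i j :
  m [lie w a, x] i j = ((i == a)%:R - (j == a)%:R) * m x i j.
Proof.
rewrite mxcoord_lie mxcoord_wt mulmxBl mulmxBr mul_scalar_mx mul_mx_scalar.
rewrite opprB addrA subrK mxE [in X in _ + X]mxE.
rewrite mul_deltaE mulE_delta mulrBl [X in _ - X]mulrC.
by case: (eqVneq i a) => [->|]; case: (eqVneq j a) => [->|]; rewrite ?mul0r ?mulr0.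
Qed.

Lemma mxcoord_lieE i j x a b : i != j ->
  m [lie E i j, x] a b = (a == i)%:R * m x j b - m x a i * (b == j)%:R.
Proof.
by move=> ij; rewrite mxcoord_lie mxcoordE // mxE [X in _ + X]mxE mul_deltaE mulE_delta.
Qed.

Lemma lieEE i j l : i != j -> j != l -> i != l -> [lie E i j, E j l] = E i l.
Proof.
move=> ij jl il; apply: mxcoord_inj; apply/matrixP => a b.
rewrite mxcoord_lieE // !mxcoordEE // eqxx andTb [i == l](negPf il).
rewrite andbF mul0r subr0.
by case: (a == i); case: (b == l); rewrite ?mul1r ?mul0r.
Qed.

Lemma mxcoord_lie_diag i j a b : i != j ->
  m [lie E i j, E j i] a b = (a == b)%:R * ((a == i)%:R - (a == j)%:R).
Proof.
move=> ij; have ji : j != i by rewrite eq_sym.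
rewrite mxcoord_lieE // !mxcoordEE // !eqxx andTb andbT.
rewrite (eq_sym a b); case: (eqVneq b a) => [->|ba].
  case: (eqVneq a i) => [->|ai]; rewrite ?(negPf ij) /= ?mul0r ?mul1r ?mulr1 //.
  by case: (a == j); rewrite /= ?mul0r ?mulr1.
rewrite /= mul0r.
case: (eqVneq a i) ba => [->|ai] ba; first by rewrite (negPf ba) (negPf ij) /= mul0r mulr0 subr0.
case: (eqVneq a j) ba => [->|aj] ba; last by rewrite /= !mul0r subr0.
by rewrite (negPf ba) mulr0 subr0 mul0r.
Qed.

Lemma lie_diagE i j : i != j ->
  [lie [lie E i j, E j i], E i j] = 2%:R *: E i j.
Proof.
move=> ij; apply: mxcoord_inj; apply/matrixP => a b.
have ji : j != i by rewrite eq_sym.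
rewrite lie_anticomm mxcoordNE mxcoord_lieE // !mxcoord_lie_diag // mxcoordZE mxcoordEE //.
rewrite eqxx (eq_sym j b) (negPf ji).
case: (eqVneq a i) => [ai|ai]; case: (eqVneq b j) => [bj|bj]; rewrite /= ?ai ?bj.
all: rewrite ?(negPf ij) ?(negPf ji) ?eqxx /= ?mul0r ?mulr0 ?subr0 ?mul1r ?sub0r ?mulr1 ?oppr0 ?mul0r ?oppr0 //.
by rewrite opprB opprK.
Qed.

Lemma supp_subspace R : is_subspace (supp R).
Proof.
split=> [i j|a x y Rx Ry i j]; first by rewrite mxcoord0 mxE eqxx.
rewrite mxcoordDE mxcoordZE; case: (eqVneq (m x i j) 0) => [->|/Rx//].
by rewrite mulr0 add0r => /Ry.
Qed.

Lemma supp_lie (R1 R2 R : rel I) x y :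
  (forall i j l, R1 i j -> R2 j l -> R i l) ->
  (forall i j l, R2 i j -> R1 j l -> R i l) ->
  supp R1 x -> supp R2 y -> supp R [lie x, y].
Proof.
move=> R12 R21 x1 y2 i j; apply: contra_neqT => nR.
rewrite mxcoord_lieS !big1 ?subrr // => l _; apply/eqP; rewrite mulf_eq0.
  by apply: contraNT nR => /norP[/y2 R2il /x1]; apply: R21.
by apply: contraNT nR => /norP[/x1 R1il /y2]; apply: R12.
Qed.

Lemma supp_subalgebra R : transitive R -> is_subalgebra (supp R).
Proof.
move=> trR; split; first exact: supp_subspace.
by move=> x y; apply: supp_lie => i j l; apply: trR.
Qed.

Lemma suppE R i j : i != j -> supp R (E i j) <-> R i j.
Proof.
move=> ij; split=> [|Rij a b]; first by apply; rewrite mxcoordEE // !eqxx oner_neq0.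
rewrite mxcoordEE //.
by case: (eqVneq a i) => [->|_]; case: (eqVneq b j) => [->|_]; rewrite ?eqxx.
Qed.

Lemma suppS R R' : (forall i j, R i j -> R' i j) -> supp R `<=` supp R'.
Proof. by move=> RR x Rx i j /Rx/RR. Qed.

Lemma supp0 R x : supp R x -> (forall i j, ~~ R i j) -> x = 0.
Proof.
move=> Rx nR; apply: mxcoord_inj; apply/matrixP => i j; rewrite mxcoord0 [RHS]mxE.
by apply/eqP; apply: contraNT (nR i j) => /Rx.
Qed.

(** The root space decomposition. *)
Lemma mxcoord_diag_decomp x : exists2 d, supp eq_op d &
  x = d + \sum_(p : I * I | p.1 != p.2) m x p.1 p.2 *: E p.1 p.2.
Proof.
set s := \sum_(p | _) _; exists (x - s); last by rewrite subrK.
move=> i j; apply: contraNT => ij; rewrite mxcoordBE mxcoord_sumE.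
rewrite (bigD1 (i, j)) //= mxcoordZE (mxcoordEE _ _ ij) !eqxx mulr1.
rewrite big1 ?addr0 ?subrr // => -[a b] /= /andP[ab neq].
rewrite mxcoordZE mxcoordEE //; move: neq; rewrite xpair_eqE (eq_sym a) (eq_sym b).
by move=> /negPf->; rewrite mulr0.
Qed.

Lemma supp_sub R V : is_subspace V -> supp eq_op `<=` V ->
  (forall i j, i != j -> R i j -> V (E i j)) -> supp R `<=` V.
Proof.
move=> sV DV RV x Rx; have [d /DV Vd ->] := mxcoord_diag_decomp x.
apply: is_subspaceD => //; apply: is_subspace_sum => // -[i j] /= ij.
case: (eqVneq (m x i j) 0) => [->|/Rx Rij].
  by rewrite scale0r; case: sV.
by apply: is_subspaceZ => //; apply: RV.
Qed.

Lemma supp_sub_offdiag R V : is_subspace V -> (forall i, ~~ R i i) ->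
  (forall i j, i != j -> R i j -> V (E i j)) -> supp R `<=` V.
Proof.
move=> sV irR RV x Rx; have [d Dd xE] := mxcoord_diag_decomp x.
have d0 : d = 0.
  apply: mxcoord_inj; apply/matrixP => i j; rewrite mxcoord0 [RHS]mxE.
  apply/eqP; apply: contraNT (irR i) => dij; move: (dij) => /Dd/eqP ji; apply: Rx.
  rewrite xE mxcoordDE mxcoord_sumE [X in _ + X]big1 ?addr0 ?[X in m d _ X]ji //.
  move=> -[a b] /= ab; rewrite mxcoordZE mxcoordEE //.
  by case: (eqVneq i a) => [->|]; rewrite ?(negPf ab) mulr0.
rewrite xE d0 add0r.
apply: is_subspace_sum => // -[i j] /= ij.
case: (eqVneq (m x i j) 0) => [->|/Rx Rij].
  by rewrite scale0r; case: sV.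
by apply: is_subspaceZ => //; apply: RV.
Qed.

Lemma diag_wt a : supp eq_op (w a).
Proof.
move=> i j; rewrite mxcoord_wtE; apply: contraNT => ij.
rewrite (negPf ij) mul0r subr0; case: (eqVneq i a) => [ia|//] /=.
by rewrite -ia (eq_sym j) (negPf ij).
Qed.

(** The polynomial [(1 + ad w_i)(ad w_j)(ad w_i)] takes the value 0 on all root
    spaces but that of [E i j], where it is [-2]. *)
Lemma mxcoord_projE x i j (y := [lie w j, [lie w i, x]]) : i != j ->
  y + [lie w i, y] = (- (2%:R * m x i j)) *: E i j.
Proof.
move=> ij; apply: mxcoord_inj; apply/matrixP => a b.
have yE : m y a b = ((a == j)%:R - (b == j)%:R) *
    (((a == i)%:R - (b == i)%:R) * m x a b).
  by rewrite /y (mxcoord_wt_lie j) (mxcoord_wt_lie i).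
clearbody y.
rewrite mxcoordDE mxcoordZE (mxcoordEE _ _ ij) (mxcoord_wt_lie i y) yE {yE y}.
have: (a == i) && (b == j) -> m x a b = m x i j by case/andP=> /eqP-> /eqP->.
have: ~~ ((a == i) && (a == j)).
  by apply: contraNN ij => /andP[/eqP<- /eqP<-].
have: ~~ ((b == i) && (b == j)).
  by apply: contraNN ij => /andP[/eqP<- /eqP<-].
move: (m x a b) (m x i j) => u v.
case: (a == i); case: (a == j); case: (b == i); case: (b == j) => //= _ _.
all: first [move=> /(_ isT)->; ring | move=> _; ring].
Qed.

(** The weights of the diagonal subalgebra off the diagonal are pairwise
    distinct, so that the projections on the weight spaces are polynomials in
    its adjoint action. *)
Lemma stable_mem_elt V x i j : is_subspace V ->
  (forall h y, supp eq_op h -> V y -> V [lie h, y]) ->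
  V x -> i != j -> m x i j != 0 -> V (E i j).
Proof.
move=> sV tV Vx ij xij.
have Vw a y : V y -> V [lie w a, y] by apply: tV; apply: diag_wt.
pose y := [lie w j, [lie w i, x]].
have Vy : V y by apply/Vw/Vw.
have Vz : V (y + [lie w i, y]) by apply: is_subspaceD => //; apply: Vw.
move: Vz; rewrite mxcoord_projE //; apply: is_subspaceVZ => //.
by rewrite oppr_eq0 mulf_neq0 // natr_neq0.
Qed.

End Coordinates.

(** * Solvable and nilpotent subalgebras in coordinates *)

Section SolvableNilpotent.
Context {k : fieldType} {r : nat}.
Local Notation g := (sl k r).
Local Notation I := 'I_r.+1.
Variable P : 'M[k]_r.+1.
Hypothesis Pu : P \in unitmx.
Hypothesis chark : [pchar k] =i pred0.
Local Notation m := (mxcoord P).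
Local Notation E := (elt P).
Local Notation supp := (coord_supp P).
Implicit Types (x y : g) (i j l : I) (R : rel I) (V : set g).

(** The two vectors span with their bracket a copy of sl_2, which is perfect and
    thus survives in the whole derived series. *)
Lemma sl2_not_solvable V i j : is_subalgebra V -> is_solvable V ->
  i != j -> V (E i j) -> V (E j i) -> False.
Proof.
move=> [sV VV] [n Vn0] ij Vij Vji.
have ji : j != i by rewrite eq_sym.
have [] : [/\ is_subspace (derived V n), derived V n (E i j), derived V n (E j i)
      & derived V n [lie E i j, E j i]].
  elim: n {Vn0} => [|n [sD Dij Dji Dh]]; first by split=> //; apply: VV.
  have sD' : is_subspace (derived V n.+1) by apply: span_subspace.
  have two0 : 2%:R != 0 :> k by apply: natr_neq0.
  split=> //.
  - apply: (is_subspaceVZ sD' two0); rewrite -(lie_diagE Pu) //.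
    exact: mem_set_bracket.
  - apply: (is_subspaceVZ sD' two0); rewrite -(lie_diagE Pu) //.
    by apply: mem_set_bracket => //; rewrite lie_anticomm; apply: is_subspaceN.
  - exact: mem_set_bracket.
move=> _ /Vn0 E0 _ _.
have := mxcoordEE Pu i j ij; rewrite E0 mxcoord0 mxE !eqxx => /esym/eqP.
by rewrite oner_eq0.
Qed.

(** Such an [x] acts on the [E i j] component by the nonzero scalar
    [x_ii - x_jj], so [E i j] survives in all the terms of the lower central
    series. *)
Lemma not_nilpotent V x i j : is_subspace V ->
  (forall h y, supp eq_op h -> V y -> V [lie h, y]) ->
  V (E i j) -> V x -> i != j -> m x i i != m x j j -> ~ is_nilpotent V.
Proof.
move=> sV tV Vij Vx ij xij [n Vn0].
have: lower_central V n (E i j).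
  elim: n {Vn0} => //= n IHn.
  apply: (stable_mem_elt Pu chark (x := [lie x, E i j]) (V := lower_central V n.+1)) => //.
  - exact: lower_central_subspace.
  - by move=> h y hd; apply: lower_central_stable => z; apply: tV.
  - exact: mem_set_bracket.
  - rewrite lie_anticomm mxcoordNE (mxcoord_lieE Pu) // !eqxx mul1r mulr1.
    by rewrite opprB subr_eq0.
move=> /Vn0 E0.
have := mxcoordEE Pu i j ij; rewrite E0 mxcoord0 mxE !eqxx => /esym/eqP.
by rewrite oner_eq0.
Qed.

(** For a labelling [f] of the indices by blocks, [a = 0] gives the
    stabiliser of the flag and [a = 1] its strictly block triangular part; for
    larger [a] these are the terms of a filtration that bounds the derived and
    the lower central series. *)
Definition flag_rel (f : I -> nat) (a : nat) : rel I := fun i j => (f i + a <= f j)%N.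

Lemma flag_subalgebra f a : is_subalgebra (supp (flag_rel f a)).
Proof. by apply: supp_subalgebra => // j i l; rewrite /flag_rel; lia. Qed.

Lemma flag_lie f a b x y :
  supp (flag_rel f a) x -> supp (flag_rel f b) y ->
  supp (flag_rel f (a + b)) [lie x, y].
Proof. by apply: supp_lie => // i j l; rewrite /flag_rel; lia. Qed.

(** When the blocks have size one, the diagonal parts commute. *)
Lemma flag_lie_diag f x y : injective f ->
  supp (flag_rel f 0) x -> supp (flag_rel f 0) y ->
  supp (flag_rel f 1) [lie x, y].
Proof.
move=> f_inj Fx Fy i j xyij; have := flag_lie Fx Fy xyij.
rewrite /flag_rel !addn0 addn1 leq_eqVlt => /orP[/eqP|//].
move=> /f_inj ij; case/negP: xyij; rewrite -{j}ij (mxcoord_lieS Pu).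
rewrite subr_eq0; apply/eqP; apply: eq_bigr => l _.
have [->|li] := eqVneq l i; first by rewrite mulrC.
have xy z z' : supp (flag_rel f 0) z -> supp (flag_rel f 0) z' -> m z i l * m z' l i = 0.
  move=> Fz Fz'; have [->|/Fz il] := eqVneq (m z i l) 0; first by rewrite mul0r.
  have [->|/Fz' il'] := eqVneq (m z' l i) 0; first by rewrite mulr0.
  have /f_inj/eqP : f l = f i by move: il il'; rewrite /flag_rel; lia.
  by rewrite (negPf li).
by rewrite (xy x y Fx Fy) (xy y x Fy Fx).
Qed.

Lemma flag_ge_empty f (b : nat) a x : (forall i, (f i < b)%N) -> (b <= a)%N ->
  supp (flag_rel f a) x -> x = 0.
Proof.
move=> fb ba /(supp0 Pu); apply => i j; rewrite /flag_rel -ltnNge.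
by have := fb j; lia.
Qed.

Lemma flag_ltn_bound (f : I -> nat) i : (f i < (\max_j f j).+1)%N.
Proof. by rewrite ltnS; apply: (leq_bigmax i). Qed.

Lemma flag_solvable f : injective f -> is_solvable (supp (flag_rel f 0)).
Proof.
move=> f_inj; exists (\max_j f j).+2.
suff derF a : derived (supp (flag_rel f 0)) a.+1 `<=` supp (flag_rel f a.+1).
  by move=> x /derF; apply: (flag_ge_empty (b := (\max_j f j).+1)) => // i; apply: flag_ltn_bound.
elim: a => [|a IHa]; apply: set_bracket_sub; try exact: supp_subspace.
  by move=> x y; apply: flag_lie_diag.
move=> x y /IHa Fx /IHa Fy; apply: (suppS (R := flag_rel f (a.+1 + a.+1))).
  by move=> i j; rewrite /flag_rel; lia.
exact: flag_lie.
Qed.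

(** Each bracket moves at least one block further from the diagonal, and there
    are finitely many blocks. *)
Lemma flag_nilpotent f : is_nilpotent (supp (flag_rel f 1)).
Proof.
exists (\max_j f j).+1.
suff lcF a : lower_central (supp (flag_rel f 1)) a `<=` supp (flag_rel f a.+1).
  by move=> x /lcF; apply: (flag_ge_empty (b := (\max_j f j).+1)) => // i; apply: flag_ltn_bound.
elim: a => [|a IHa] //=; apply: set_bracket_sub; first exact: supp_subspace.
by move=> x y Fx /IHa Fy; rewrite -add1n; apply: flag_lie.
Qed.

Lemma diag_flag f : supp eq_op `<=` supp (flag_rel f 0).
Proof. by apply: suppS => i j /eqP->; rewrite /flag_rel addn0. Qed.

(** Any larger subalgebra contains some [E i j] whose opposite [E j i] lies in
    the flag stabiliser, hence a copy of sl_2. *)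
Lemma flag_max_solvable f : injective f -> is_max_solvable (supp (flag_rel f 0)).
Proof.
move=> f_inj; split; [exact: flag_subalgebra|exact: flag_solvable|].
move=> B sB solB FB; apply/seteqP; split=> // x Bx i j xij.
rewrite /flag_rel addn0 leqNgt; apply/negP => fji.
have ij : i != j by apply: contraTneq fji => ->; rewrite ltnn.
have ji : j != i by rewrite eq_sym.
apply: (sl2_not_solvable sB solB ij).
  apply: (stable_mem_elt Pu chark (x := x)) => //; first by case: sB.
  move=> h y /diag_flag hd By; case: (sB) => _; apply => //; apply: FB; exact: hd.
by apply: FB; apply/(suppE Pu) => //; rewrite /flag_rel addn0 ltnW.
Qed.

(** The root vectors of a solvable subalgebra [B] containing the diagonal define
    a strict partial order on the indices; any linear extension of it gives a
    flag stabilised by [B]. *)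
Lemma solvable_sub_flag (B : set g) : is_subalgebra B -> is_solvable B ->
  supp eq_op `<=` B ->
  exists2 f : I -> nat, injective f & B `<=` supp (flag_rel f 0).
Proof.
move=> sB solB DB.
have stB h y : supp eq_op h -> B y -> B [lie h, y].
  by move=> /DB Bh By; case: (sB) => _; apply.
pose R i j := (i != j) && `[< B (E i j) >].
have R_irr i j : R i j -> ~~ R j i.
  move=> /andP[ij /asboolP Bij]; apply/negP => /andP[_ /asboolP Bji].
  exact: (sl2_not_solvable sB solB ij).
have R_tr j i l : R i j -> R j l -> R i l.
  move=> Rij Rjl.
  have il : i != l by apply: contraTneq Rjl => <-; apply: R_irr.
  have /andP[ij /asboolP Bij] := Rij; have /andP[jl /asboolP Bjl] := Rjl.
  apply/andP; split=> //; apply/asboolP; rewrite -(lieEE Pu ij jl il).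
  by case: (sB) => _; apply.
pose h i := #|[pred j | R j i]|.
have hR i j : R i j -> (h i < h j)%N.
  move=> Rij; apply: proper_card; apply/properP; split.
    by apply/fintype.subsetP => l; rewrite !inE => /R_tr; apply.
  by exists i; rewrite inE // ?Rij //; apply/negP => Rii; move: (R_irr _ _ Rii); rewrite Rii.
(* The multiple of [r.+1] makes [h] prevail, and adding [i] breaks the ties. *)
pose f i := (h i * r.+1 + i)%N.
exists f.
  move=> i j fij; apply/val_inj => /=.
  have := congr1 (modn^~ r.+1) fij; rewrite /f !modnMDl !modn_small //; exact: ltn_ord.
move=> x Bx i j xij; rewrite /flag_rel addn0.
have [->|ij] := eqVneq i j; first by rewrite leqnn.
have /hR : R i j.
  rewrite /R ij; apply/asboolP; apply: (stable_mem_elt Pu chark (x := x)) => //.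
  by case: sB.
rewrite /f; have := ltn_ord i; nia.
Qed.

End SolvableNilpotent.

(** * A basis adapted to a Cartan and a Borel subalgebra *)

Section Adapted.
Context {k : fieldType} {r : nat}.
Local Notation g := (sl k r).
Local Notation I := 'I_r.+1.
Implicit Types (x y : g) (i j l : I) (t b : set g).

Lemma diag_similarP (P : 'M[k]_r.+1) x : P \in unitmx ->
  coord_supp P eq_op x <-> mxred.similar_diag P (sl_mx x).
Proof.
move=> Pu; split=> [xd|/(mxred.similar_diagP _ Pu) xd i j].
  apply/(mxred.similar_diagP _ Pu) => i j ij; apply/eqP.
  by apply: contraNT ij => /xd/eqP->.
by apply: contraNT => ij; rewrite [mxcoord P x i j]xd.
Qed.

Lemma diag_lie (P : 'M[k]_r.+1) h x i j : P \in unitmx ->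
  coord_supp P eq_op h ->
  mxcoord P [lie h, x] i j = (mxcoord P h i i - mxcoord P h j j) * mxcoord P x i j.
Proof.
move=> Pu hd; rewrite (mxcoord_lieS Pu).
have h0 a c : a != c -> mxcoord P h a c = 0.
  by move=> ac; apply/eqP; apply: contraNT ac => /hd.
rewrite (bigD1 i) //= [X in _ + X - _]big1 => [|a ai].
  rewrite [X in _ - X](bigD1 j) //= [X in _ - (_ + X)]big1 => [|a aj].
    rewrite !addr0 mulrBl. by rewrite [X in _ - X]mulrC.
  by rewrite (h0 a j) ?mulr0.
by rewrite h0 ?mul0r // eq_sym.
Qed.

Lemma diag_abelian (P : 'M[k]_r.+1) x y : P \in unitmx ->
  coord_supp P eq_op x -> coord_supp P eq_op y -> [lie x, y] = 0.
Proof.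
move=> Pu xd yd; apply: (mxcoord_inj Pu); apply/matrixP => i j.
rewrite diag_lie // mxcoord0 [RHS]mxE.
have [->|] := eqVneq i j; first by rewrite subrr mul0r.
by move=> ij; rewrite [mxcoord P y i j](_ : _ = 0) ?mulr0 //; apply/eqP; apply: contraNT ij => /yd.
Qed.

(** For [x] in a split Cartan subalgebra, [ad x] is diagonalisable, and nilpotent
    on the subalgebra, hence zero there. *)
Lemma split_cartan_abelian t x y : is_split_cartan t -> t x -> t y -> [lie x, y] = 0.
Proof.
move=> [[_ [n tn0] _] diagt] tx ty; have [P Pu /(diag_similarP _ Pu) xd] := diagt x tx.
have adn N : lower_central t N (iter N (bracket x) y).
  by elim: N => //= N IHN; apply: mem_set_bracket.
have adnE N i j : mxcoord P (iter N (bracket x) y) i j =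
    (mxcoord P x i i - mxcoord P x j j) ^+ N * mxcoord P y i j.
  by elim: N => [|N IHN] /=; rewrite ?mul1r // diag_lie // IHN mulrA exprS.
apply: (mxcoord_inj Pu); apply/matrixP => i j.
rewrite diag_lie // mxcoord0 [RHS]mxE.
have := adnE n i j; rewrite (tn0 _ (adn n)) mxcoord0 mxE => /esym/eqP.
rewrite mulf_eq0 expf_eq0 => /orP[/andP[_ /eqP->]|/eqP->].
  by rewrite mul0r.
by rewrite mulr0.
Qed.

(** A finite family whose span has the largest possible dimension. *)
Lemma subspace_finite_span (t : set g) : exists s : seq 'M[k]_r.+1,
  (forall A, A \in s -> exists2 x, t x & A = sl_mx x) /\
  (forall x, t x -> sl_mx x \in <<s>>%VS).
Proof.
(* [D] collects the dimensions spanned by finite families in [t]. *)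
pose Q (s : seq 'M[k]_r.+1) := forall A, A \in s -> exists2 x, t x & A = sl_mx x.
pose D : pred nat := fun d => `[< exists2 s, Q s & \dim <<s>>%VS = d >].
have D0 : exists d, D d.
  by exists (\dim <<[::] : seq 'M[k]_r.+1>>%VS); apply/asboolP; exists [::].
have Dle d : D d -> (d <= \dim (fullv : {vspace 'M[k]_r.+1}))%N.
  by move=> /asboolP[s _ <-]; apply: dimvS; apply: subvf.
case: (ex_maxnP D0 Dle) => d /asboolP[s Qs sd] dmax.
exists s; split=> // x tx.
have Qxs : Q (sl_mx x :: s).
  by move=> A; rewrite inE => /orP[/eqP->|/Qs//]; exists x.
have /dmax le_d : D (\dim <<sl_mx x :: s>>%VS) by apply/asboolP; exists (sl_mx x :: s).
have : (<<s>> == <<sl_mx x :: s>>)%VS.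
  rewrite eqEdim sd le_d andbT; apply: vector.sub_span => A As.
  by rewrite inE As orbT.
by move=> /eqP->; apply: memv_span; rewrite inE eqxx.
Qed.

(** A common diagonalising basis exists for a finite spanning family, hence for
    the Cartan subalgebra [t]; conversely a matrix diagonal in that basis
    commutes with [t], so lies in its normaliser, which is [t]. *)
Lemma split_cartan_diag t : is_split_cartan t ->
  exists2 P : 'M[k]_r.+1, P \in unitmx & t = coord_supp P eq_op.
Proof.
move=> sct; have [s [st ts]] := subspace_finite_span t.
have [P Pu /allP/= Ps] : exists2 P : 'M[k]_r.+1, P \in unitmx &
    all [pred A | mxred.similar_diag P A] s.
  apply/mxred.codiagonalizableP; split=> [A B /st[x tx ->] /st[y ty ->]|A /st[x tx ->]].
    apply/eqP; rewrite -subr_eq0; apply/eqP.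
    by have /(congr1 (@sl_mx k r)) := split_cartan_abelian sct tx ty.
  by case: sct => _; apply.
exists P => //.
have tD : t `<=` coord_supp P eq_op.
  move=> x tx; apply/(diag_similarP _ Pu); apply/(mxred.similar_diagP _ Pu) => i j ij.
  rewrite (coord_span (X := in_tuple s) (ts x tx)) mulmx_sumr mulmx_suml summxE.
  apply: big1 => l _; rewrite -scalemxAr -scalemxAl mxE.
  have /Ps /(mxred.similar_diagP _ Pu)/(_ i j ij) -> : s`_l \in s by apply: mem_nth.
  by rewrite mulr0.
apply/seteqP; split=> // x xd; case: sct => -[[[t0 _] _] _ <-] _ y ty.
by rewrite (diag_abelian Pu xd (tD _ ty)).
Qed.

Lemma coord_supp_perm (P : 'M[k]_r.+1) (s : 'S_r.+1) (R : rel I) : P \in unitmx ->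
  coord_supp (perm_mx s *m P) R = coord_supp P (fun i j => R (s^-1 i)%g (s^-1 j)%g).
Proof.
move=> Pu.
have cE x i j : mxcoord (perm_mx s *m P) x i j = mxcoord P x (s i) (s j).
  have pinv : invmx (perm_mx s *m P) = invmx P *m perm_mx s^-1.
    by rewrite perm_mxV; apply: invrM => //; apply: unitmx_perm.
  rewrite /mxcoord pinv -!mulmxA.
  by rewrite -row_permE !mulmxA -col_permE mxE [LHS]mxE.
apply/seteqP; split=> x xR i j.
  by move=> xij; apply: xR; rewrite cE !permKV.
by rewrite cE => /xR; rewrite !permK.
Qed.

Lemma rank_perm (f : I -> nat) : injective f ->
  exists s : 'S_r.+1, forall i j, (f i <= f j)%N = (s i <= s j)%N.
Proof.
move=> f_inj; pose c i := #|[pred l | (f l < f i)%N]|.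
have cP i : (c i < r.+1)%N.
  rewrite -[X in (_ < X)%N](card_ord r.+1); apply: proper_card; apply/properP.
  by split; [apply/fintype.subsetP|exists i => //; rewrite inE ltnn].
have cS i j : (f i < f j)%N -> (c i < c j)%N.
  move=> fij; apply: proper_card; apply/properP; split.
    by apply/fintype.subsetP => l; rewrite !inE => /ltn_trans; apply.
  by exists i; rewrite inE ?fij ?ltnn.
have cE i j : (f i <= f j)%N = (c i <= c j)%N.
  have [/cS|/cS|/f_inj->] := ltngtP (f i) (f j); last by rewrite leqnn.
    by move/ltnW->.
  by rewrite ltnNge => /negbTE->.
pose s i := Ordinal (cP i).
have s_inj : injective s.
  move=> i j /(congr1 val) /= cij; apply: f_inj; apply/eqP.
  by rewrite eqn_leq !cE cij leqnn.
by exists (perm s_inj) => i j; rewrite !permE /= cE.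
Qed.

(** By maximality the Borel subalgebra is the stabiliser of a complete flag
    compatible with the diagonalising basis; sorting this basis along the flag
    makes it upper triangular. *)
Lemma borel_pair_adapted (chark : [pchar k] =i pred0) t b : is_borel_pair t b ->
  exists2 P : 'M[k]_r.+1, P \in unitmx &
    t = coord_supp P eq_op /\ b = coord_supp P upper_rel.
Proof.
move=> [/split_cartan_diag[P Pu tE] [bsub bsol bmax] tb].
have [f f_inj bf] : exists2 f : I -> nat, injective f & b `<=` coord_supp P (flag_rel f 0).
  by apply: solvable_sub_flag => //; rewrite -tE.
have [s fs] := rank_perm f_inj.
exists (perm_mx s^-1%g *m P); first by rewrite unitmx_mul unitmx_perm.
rewrite !coord_supp_perm // invgK; split.
  rewrite tE; apply/seteqP; split; apply: suppS => i j.
    by move/eqP->.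
  by move/eqP/perm_inj->.
rewrite -(bmax _ _ _ bf); last exact: flag_solvable.
  by apply/seteqP; split; apply: suppS => i j; rewrite /flag_rel /upper_rel addn0 fs.
exact: flag_subalgebra.
Qed.

Lemma flag_borel_pair (chark : [pchar k] =i pred0) t (P : 'M[k]_r.+1) (f : I -> nat) :
  P \in unitmx -> is_split_cartan t -> t = coord_supp P eq_op -> injective f ->
  is_borel_pair t (coord_supp P (flag_rel f 0)).
Proof.
move=> Pu sct tE f_inj; split=> //; first exact: flag_max_solvable.
by rewrite tE; apply: diag_flag.
Qed.

End Adapted.

(** * Roots and root vectors *)

Section RootsInCoordinates.
Context {k : fieldType} {r : nat}.
Local Notation g := (sl k r).
Local Notation I := 'I_r.+1.

Variable P : 'M[k]_r.+1.
Hypothesis Pu : P \in unitmx.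
Hypothesis chark : [pchar k] =i pred0.
Local Notation m := (mxcoord P).
Local Notation E := (elt P).
Local Notation supp := (coord_supp P).
Local Notation t := (coord_supp P eq_op).
Local Notation b := (coord_supp P upper_rel).
Implicit Types (x y : g) (i j l : I).

Definition rt i j : t -> k := fun h => m (\val h) i i - m (\val h) j j.

Definition wt_t a : t := exist _ (wt P a) (mem_set (@diag_wt k r P Pu chark a)).

Lemma rt_wt i j a : rt i j (wt_t a) = (i == a)%:R - (j == a)%:R.
Proof.
rewrite /rt /= !(mxcoord_wtE Pu chark) !eqxx !andbb.
by rewrite opprB addrA subrK.
Qed.

(** Evaluation at the coweights [wt l] recovers the indices of a root; in
    characteristic 2 the indices could be swapped. *)
Lemma diff_delta_inj i j a c : i != j ->
  (forall l, (a == l)%:R - (c == l)%:R = (i == l)%:R - (j == l)%:R :> k) ->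
  a = i /\ c = j.
Proof.
move=> ij acij.
have two0 : 1 + 1 != 0 :> k by apply: (natr_neq0 chark (p := 2)).
have eq1 (p q : bool) : p%:R - q%:R = 1 :> k -> p.
  case: p => //; case: q => /eqP; rewrite ?subr0 ?sub0r.
    by rewrite eq_sym -addr_eq0 (negPf two0).
  by rewrite eq_sym oner_eq0.
split; apply/eqP.
  by have := acij i; rewrite eqxx (eq_sym j) (negPf ij) subr0 => /eq1.
have := acij j; rewrite eqxx (negPf ij) sub0r => /(congr1 -%R).
by rewrite opprB opprK => /eq1.
Qed.

Lemma rtN i j : \- rt i j = rt j i.
Proof. by apply/funext => h; rewrite /= /rt opprB. Qed.

Lemma rtD i j l : rt i j \+ rt j l = rt i l.
Proof. by apply/funext => h; rewrite /= /rt addrA subrK. Qed.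

Lemma rt_spaceP i j x : i != j ->
  root_space (rt i j) x -> x = m x i j *: E i j.
Proof.
move=> ij xij; apply: (mxcoord_inj Pu); apply/matrixP => a c.
rewrite mxcoordZE (mxcoordEE Pu) //.
case: (boolP ((a == i) && (c == j))) => [/andP[/eqP-> /eqP->]|nac].
  by rewrite mulr1.
rewrite mulr0; apply/eqP; apply: contraNT nac => xac.
suff [-> ->] : a = i /\ c = j by rewrite !eqxx.
apply: diff_delta_inj => // l; apply: (mulIf xac).
have := congr1 (fun y => m y a c) (xij (wt_t l)); rewrite /= mxcoordZE rt_wt.
by rewrite (mxcoord_wt_lie Pu).
Qed.

Lemma rt_space i j : i != j -> root_space (rt i j) (E i j).
Proof.
move=> ij [h ht] /=; apply: (mxcoord_inj Pu); apply/matrixP => a c.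
rewrite (diag_lie _ _ _ Pu (set_mem ht)) mxcoordZE (mxcoordEE Pu) //.
by have [->|] := eqVneq a i; have [->|] := eqVneq c j; rewrite /= ?mulr0.
Qed.

Lemma elt_neq0 i j : i != j -> E i j != 0.
Proof.
move=> ij; apply/eqP => /(congr1 (fun y => m y i j)).
by rewrite (mxcoordEE Pu) // mxcoord0 mxE !eqxx => /eqP; rewrite oner_eq0.
Qed.

Lemma rt_root i j : i != j -> is_root (rt i j).
Proof.
move=> ij; split; last by exists (E i j); [exact: rt_space|exact: elt_neq0].
by exists (wt_t i); rewrite rt_wt eqxx (eq_sym j) (negPf ij) subr0 oner_neq0.
Qed.

(** A root vector with no off-diagonal entry would commute with the diagonal
    subalgebra, hence have weight zero. *)
Lemma is_rootP (a : t -> k) : is_root a -> exists i j, i != j /\ a = rt i j.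
Proof.
move=> [[h0 ah0] [x xa x0]].
case: (boolP [exists p : I * I, (p.1 != p.2) && (m x p.1 p.2 != 0)]).
  move=> /existsP[[i j] /= /andP[ij xij]]; exists i, j; split=> //.
  apply/funext => h; apply: (mulIf xij); rewrite -mxcoordZE -xa.
  by rewrite (diag_lie _ _ _ Pu (set_mem (valP h))).
move=> /existsPn xdiag; case/eqP: x0.
apply: (mxcoord_inj Pu); apply/matrixP => i j; rewrite mxcoord0 [RHS]mxE.
have [<-|ij] := eqVneq i j; last first.
  by have := xdiag (i, j); rewrite /= ij negbK => /eqP.
have := congr1 (fun y => m y i i) (xa h0); rewrite mxcoordZE.
rewrite (diag_lie _ _ _ Pu (set_mem (valP h0))) subrr mul0r => /esym/eqP.
by rewrite mulf_eq0 (negPf ah0) => /eqP.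
Qed.

Lemma rt_positive i j : (i < j)%N -> is_positive b (rt i j).
Proof.
move=> ij; have nij : i != j by rewrite neq_ltn ij.
split; first exact: rt_root.
move=> x /(rt_spaceP nij)->; apply: (is_subspaceZ _ (supp_subspace P upper_rel)).
by apply/(suppE Pu) => //; rewrite /upper_rel ltnW.
Qed.

Lemma is_positiveP (a : t -> k) : is_positive b a ->
  exists i j, (i < j)%N /\ a = rt i j.
Proof.
move=> [/is_rootP[i [j [ij ->]]] sb]; exists i, j; split=> //.
have /(suppE Pu _ ij) := sb _ (rt_space ij).
by rewrite /upper_rel ltn_neqAle ij.
Qed.

(** A longer root [eps_i - eps_j] splits off the simple root
    [eps_i - eps_(i+1)]. *)
Lemma is_simpleP (a : t -> k) : is_simple b a ->
  exists i j, j = i.+1 :> nat /\ a = rt i j.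
Proof.
move=> [/is_positiveP[i [j [ij ->]]] ns]; exists i, j; split=> //.
apply/eqP; rewrite eqn_leq ij andbT leqNgt; apply/negP => ij'.
have lr : (i.+1 < r.+1)%N by apply: leq_trans ij _; have := ltn_ord j; lia.
apply: ns; exists (rt i (Ordinal lr)), (rt (Ordinal lr) j); split.
- exact: rt_positive.
- exact: rt_positive.
- by rewrite rtD.
Qed.

(** Any other positive root can be extended to the left or to the right. *)
Lemma is_highestP (a : t -> k) : is_highest b a ->
  (0 < r)%N /\ a = rt ord0 ord_max.
Proof.
move=> [/is_positiveP[i [j [ij ->]]] hi].
have i0 : i = ord0.
  apply/eqP; apply: contraT => i0.
  have i_gt0 : ((ord0 : I) < i)%N by rewrite lt0n.
  case: (hi _ (rt_positive i_gt0)).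
  have -> : rt i j \+ rt ord0 i = rt ord0 j.
    by rewrite -(rtD ord0 i j); apply/funext => h /=; rewrite addrC.
  by apply: rt_root; rewrite neq_ltn (ltn_trans i_gt0 ij).
have jr : j = ord_max.
  apply/eqP; apply: contraT => jr.
  have j_lt : (j < (ord_max : I))%N by move: jr; rewrite -val_eqE /= ltn_neqAle -ltnS ltn_ord andbT.
  case: (hi _ (rt_positive j_lt)); rewrite rtD.
  by apply: rt_root; rewrite neq_ltn (ltn_trans ij j_lt).
by rewrite -i0 -jr; split=> //; move: ij; rewrite i0 jr.
Qed.

Lemma root_vectorP (e : (t -> k) -> g) i j : root_vectors e -> i != j ->
  exists2 c, c != 0 & e (rt i j) = c *: E i j.
Proof.
move=> eP ij; have [/(rt_spaceP ij) eE e0] := eP _ (rt_root ij).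
exists (m (e (rt i j)) i j) => //; apply: contraNneq e0 => c0.
by rewrite eE c0 scale0r.
Qed.

End RootsInCoordinates.

(** * Block triangular parabolics, their nilradicals and centres *)

Section ParabolicsInCoordinates.
Context {k : fieldType} {r : nat}.
Local Notation g := (sl k r).
Local Notation I := 'I_r.+1.
Variable P : 'M[k]_r.+1.
Hypothesis Pu : P \in unitmx.
Hypothesis chark : [pchar k] =i pred0.
Local Notation m := (mxcoord P).
Local Notation E := (elt P).
Local Notation supp := (coord_supp P).
Local Notation b := (coord_supp P upper_rel).
Local Notation b_ := (coord_supp P lower_rel).
Implicit Types (x y : g) (i j l : I) (V : set g).

(** [beta] is defined beyond the indices so that it can be built by induction. *)
Definition level (beta : nat -> nat) : I -> nat := fun i => beta i.

Definition par (beta : nat -> nat) : set g := supp (flag_rel (level beta) 0).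
Definition par_opp (beta : nat -> nat) : set g := supp (fun i j => (beta j <= beta i)%N).
Definition par_nil (beta : nat -> nat) : set g := supp (flag_rel (level beta) 1).
Definition corner (beta : nat -> nat) : set g :=
  supp (fun i j => (beta i <= beta 0)%N && (beta r <= beta j)%N).

Variable beta : nat -> nat.
Hypothesis beta_mono : {homo beta : i j / (i <= j)%N}.

(** A path of descending steps inside a block; stated for an abstract [W] so as to
    serve the lower triangular and the upper triangular root vectors. *)
Lemma chain_rel (W : I -> I -> Prop) :
  (forall i j l, (l < j < i)%N -> W i j -> W j l -> W i l) ->
  (forall i j, i = j.+1 :> nat -> beta i = beta j -> W i j) ->
  forall i j, (j < i)%N -> (beta i <= beta j)%N -> W i j.
Proof.
move=> Wtr Wstep i j; have [n] := ubnP (i : nat); elim: n i => // n IHn i.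
rewrite ltnS => i_n ji bij.
have i_r := ltn_ord i.
have li : (i.-1 < r.+1)%N by lia.
have mono_i := @beta_mono i.-1 i (leq_pred i).
have mono_j : (beta j <= beta i.-1)%N by apply: beta_mono; lia.
have step : W i (Ordinal li) by apply: Wstep => /=; lia.
have [ij'|ij'] := eqVneq (j : nat) i.-1.
  by have -> : j = Ordinal li by apply: val_inj.
apply: (Wtr i (Ordinal li) j) => //=; first by lia.
by apply: IHn => /=; lia.
Qed.

Lemma par_sub V : is_subalgebra V -> b `<=` V ->
  (forall i j, i = j.+1 :> nat -> beta i = beta j -> V (E i j)) -> par beta `<=` V.
Proof.
move=> [sV VV] bV Vstep; apply: (supp_sub Pu) => //.
  by apply: subset_trans bV; apply: suppS => i j /eqP->; rewrite /upper_rel.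
move=> i j ij; rewrite /flag_rel addn0 /level => bij.
have [ji|ij'] := ltnP j i; last by apply: bV; apply/(suppE Pu).
apply: (chain_rel (W := fun i j => V (E i j))) ji bij => // a c l /andP[lc ca] Vac Vcl.
rewrite -(lieEE Pu (j := c)); first exact: VV.
all: rewrite -val_eqE /=; lia.
Qed.

Lemma par_opp_sub V : is_subalgebra V -> b_ `<=` V ->
  (forall i j, i = j.+1 :> nat -> beta i = beta j -> V (E j i)) -> par_opp beta `<=` V.
Proof.
move=> [sV VV] bV Vstep; apply: (supp_sub Pu) => //.
  by apply: subset_trans bV; apply: suppS => i j /eqP->; rewrite /lower_rel.
move=> i j ij /= bij.
have [ji|ij'] := ltnP i j; last by apply: bV; apply/(suppE Pu).
apply: (chain_rel (W := fun i j => V (E j i))) ji bij => // a c l /andP[lc ca] Vac Vcl.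
rewrite -(lieEE Pu (j := c)); first exact: VV.
all: rewrite -val_eqE /=; lia.
Qed.

Lemma upper_par : b `<=` par beta.
Proof. by apply: suppS => i j ij; rewrite /flag_rel addn0; apply: beta_mono. Qed.

Lemma lower_par_opp : b_ `<=` par_opp beta.
Proof. by apply: suppS => i j ij; apply: beta_mono. Qed.

Lemma par_subalgebra : is_subalgebra (par beta).
Proof. exact: flag_subalgebra. Qed.

Lemma par_opp_subalgebra : is_subalgebra (par_opp beta).
Proof. by apply: supp_subalgebra => // j i l /=; lia. Qed.

(** A traceless scalar matrix vanishes in characteristic zero. *)
Lemma exists_diag_neq x i : m x i i != 0 -> exists l, m x l l != m x i i.
Proof.
move=> xii; apply/existsP; apply: contraNT xii => /existsPn xl.
have := mxcoord_tr Pu x; rewrite /mxtrace (eq_bigr (fun=> m x i i)) => [|l _].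
  rewrite sumr_const card_ord -mulr_natl => /eqP.
  by rewrite mulf_eq0 (negPf (natr_neq0 chark _)).
by have := xl l; rewrite negbK => /eqP.
Qed.

(** A nilpotent ideal meets neither the Levi part (any root vector there comes
    with its opposite in the parabolic, so the ideal would contain a semisimple
    coroot) nor the diagonal (a non-scalar diagonal part acts on some root vector
    of the Borel by a nonzero scalar). *)
Lemma nilpotent_ideal_sub J : is_ideal J (par beta) -> is_nilpotent J ->
  J `<=` par_nil beta.
Proof.
move=> [sJ Jp pJ] nilJ x Jx i j xij.
have dJ h y : supp eq_op h -> J y -> J [lie h, y].
  by move=> /diag_flag hd; apply: pJ; apply: hd.
have Jmem y a c : J y -> a != c -> m y a c != 0 -> J (E a c).
  by move=> Jy ac; apply: (stable_mem_elt Pu chark).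
have nilE y a c : J (E a c) -> J y -> a != c -> m y a a = m y c c.
  move=> Jac Jy ac; apply/eqP; apply: contraT => yac.
  by case: (not_nilpotent Pu chark sJ dJ Jac Jy ac yac).
have := Jp _ Jx _ _ xij; rewrite /flag_rel /level addn0 addn1 leq_eqVlt.
move=> /orP[/eqP bij|//]; exfalso.
have [ij|ij] := eqVneq i j.
  move: xij; rewrite -ij => /exists_diag_neq[l xl].
  (* A root vector of the Borel, whatever the order of the two indices. *)
  have [a [c [ac xac]]] : exists a c : I, (a < c)%N /\ m x a a != m x c c.
    have [il|li|il] := ltngtP i l.
    - by exists i, l; rewrite eq_sym.
    - by exists l, i.
    - by move: xl; rewrite (val_inj il) eqxx.
  have nac : a != c by rewrite neq_ltn ac.
  have Jac : J (E a c).
    apply: (Jmem [lie E a c, x]) => //.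
      by apply: pJ => //; apply: upper_par; apply/(suppE Pu) => //; apply: ltnW.
    by rewrite (mxcoord_lieE Pu) // !eqxx mul1r mulr1 subr_eq0 eq_sym.
  by case/eqP: xac; apply: nilE.
have Jij := Jmem _ _ _ Jx ij xij; have ji : j != i by rewrite eq_sym.
have Jh : J [lie E j i, E i j].
  by apply: pJ => //; apply/(suppE Pu) => //; rewrite /flag_rel /level addn0 bij.
have := nilE _ _ _ Jij Jh ij; rewrite !(mxcoord_lie_diag Pu) // !eqxx.
rewrite (negPf ij) (negPf ji) !mul1r sub0r subr0 => /eqP.
by rewrite -subr_eq0 -opprD oppr_eq0 -(natrD _ 1 1) (negPf (natr_neq0 chark _)).
Qed.

(** The strictly block triangular part is itself a nilpotent ideal, and contains
    the others. *)
Lemma nilradical_par : nilradical (par beta) = par_nil beta.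
Proof.
apply/seteqP; split.
  apply: span_sub; first exact: supp_subspace.
  by move=> x [J [idJ nilJ]]; apply: nilpotent_ideal_sub.
move=> x Nx; apply: sub_span; exists (par_nil beta) => //; split.
  split; first exact: supp_subspace.
    by apply: suppS => i j; rewrite /flag_rel; lia.
  by move=> y z py Nz; apply: (flag_lie Pu (a := 0) (b := 1)).
exact: (flag_nilpotent Pu).
Qed.

Hypothesis beta_cut : (beta 0 < beta r)%N.

Lemma corner_par_nil : corner beta `<=` par_nil beta.
Proof.
apply: suppS => i j /andP[bi bj]; rewrite /flag_rel /level.
by move: beta_cut; lia.
Qed.

(** Bracketing with the root vectors of the first row and of the last column
    detects the components outside the corner block. *)
Lemma centre_par_nil : centre (par_nil beta) = corner beta.
Proof.
have bmin i : (beta 0 <= beta i)%N by apply: beta_mono.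
have bmax i : (beta i <= beta r)%N by apply: beta_mono; rewrite -ltnS.
apply/seteqP; split=> x; last first.
  move=> Zx; split=> [|y Ny]; first exact: corner_par_nil.
  apply: (supp0 Pu (R := fun _ _ => false)) => //.
  apply: supp_lie Zx Ny => // i j l; rewrite /flag_rel /level.
    by have := bmax l; lia.
  by have := bmin i; lia.
move=> [Nx cx] i j xij; have := Nx _ _ xij; rewrite /flag_rel /level => bij.
have ij : i != j by apply: contraTneq bij => ->; lia.
apply/andP; split; rewrite leqNgt; apply/negP => bb.
  have i0 : ord0 != i by apply: contraTneq bb => <-; rewrite ltnn.
  have N0i : par_nil beta (E ord0 i).
    by apply/(suppE Pu) => //; rewrite /flag_rel /level addn1.
  have := congr1 (fun y => m y ord0 j) (cx _ N0i).
  rewrite lie_anticomm mxcoordNE (mxcoord_lieE Pu) // eqxx mul1r (eq_sym j) (negPf ij) mulr0 subr0.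
  by rewrite mxcoord0E => /eqP; rewrite oppr_eq0 (negPf xij).
have jr : j != ord_max by apply: contraTneq bb => ->; rewrite ltnn.
have Njr : par_nil beta (E j ord_max).
  by apply/(suppE Pu) => //; rewrite /flag_rel /level addn1.
have := congr1 (fun y => m y i ord_max) (cx _ Njr).
rewrite lie_anticomm mxcoordNE (mxcoord_lieE Pu) // eqxx mulr1 (negPf ij) mul0r sub0r.
by rewrite mxcoord0E => /eqP; rewrite opprK (negPf xij).
Qed.

Lemma lie_par_corner x y : par beta x -> corner beta y -> corner beta [lie x, y].
Proof.
by apply: supp_lie => // i j l; rewrite /flag_rel /level; lia.
Qed.

Lemma lie_corner_any x y : corner beta x -> par beta [lie x, y].
Proof.
move=> Zx; apply: (supp_lie Pu (R2 := fun _ _ => true)) Zx _ => // i j l.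
  by move=> /andP[bi _] _; rewrite /flag_rel /level addn0; apply: leq_trans bi _; apply: beta_mono.
move=> _ /andP[_ bl]; rewrite /flag_rel /level addn0; apply: leq_trans bl.
by apply: beta_mono; rewrite -ltnS.
Qed.

Lemma lie_corner x y : corner beta x -> corner beta y -> [lie x, y] = 0.
Proof.
move=> Zx /corner_par_nil Ny; move: Zx; rewrite -centre_par_nil => -[_]; exact.
Qed.

(** From the highest root vector, brackets with the first column of the first
    block and with the last row of the last block reach every unit of the
    corner. *)
Lemma corner_sub V : is_subspace V ->
  (forall x y, par beta x -> V y -> V [lie x, y]) ->
  V (E ord0 ord_max) -> corner beta `<=` V.
Proof.
move=> sV pV V0r; apply: (supp_sub_offdiag Pu) => //.
  by move=> i; apply/negP => /andP[]; move: beta_cut; lia.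
move=> i j ij /andP[bi bj].
have or : ord0 != ord_max :> I.
  by apply/eqP => or; move: beta_cut; rewrite -[r]/(val (ord_max : I)) -or ltnn.
have ir : i != ord_max by apply: contraTneq bi => -> /=; rewrite -ltnNge.
have Vir : V (E i ord_max).
  have [->//|i0] := eqVneq i ord0; rewrite -(lieEE Pu i0 or ir).
  by apply: pV => //; apply/(suppE Pu) => //; rewrite /flag_rel addn0.
have [->//|jr] := eqVneq j ord_max; have rj : ord_max != j by rewrite eq_sym.
rewrite -(lieEE Pu ir rj ij) lie_anticomm; apply: is_subspaceN => //.
by apply: pV => //; apply/(suppE Pu) => //; rewrite /flag_rel addn0.
Qed.

End ParabolicsInCoordinates.

(** * Subalgebras of the affine algebra in low degree *)

Section LoopGrading.
Context {k : fieldType} {r : nat}.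
Local Notation g := (sl k r).
Local Notation aff := (affine k r).
Implicit Types (f h : loop g) (x y : aff) (V : set g).

Lemma big_finsupp_delta (V : lmodType k) (W : lmodType k) (f : loop V)
    (F : V -> W) (l : int) : F 0 = 0 ->
  \sum_(j <- finsupp f) (if l == j then F (f j) else 0) = F (f l).
Proof.
move=> F0; rewrite -big_mkcond /= (eq_bigl (pred1 l)); last by move=> j; rewrite eq_sym.
case: (finsuppP f l) => [nl|lf].
  by rewrite F0 big1_seq // => j /andP[/eqP-> jf]; rewrite jf in nl.
by rewrite -big_filter filter_pred1_uniq ?fset_uniq ?big_seq1.
Qed.

Lemma loop_bracketE f h l :
  loop_bracket f h l = \sum_(i <- finsupp f) [lie f i, h (l - i)].
Proof.
rewrite /loop_bracket /loop_ext2 /loop_ext loop_sum; apply: eq_bigr => i _.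
rewrite loop_sum -(big_finsupp_delta h (l - i) (lie0r (f i))).
apply: eq_bigr => j _; rewrite monoE; congr (if _ then _ else _).
by rewrite subr_eq addrC.
Qed.

Lemma loop_derivE f l : loop_deriv f l = l%:~R *: f l.
Proof.
rewrite /loop_deriv /loop_ext loop_sum.
rewrite -(big_finsupp_delta f l (scaler0 _ (l%:~R : k))).
apply: eq_bigr => j _; rewrite loopZ monoE.
by case: eqP => [->|]; rewrite ?scaler0.
Qed.

Lemma aff_loop_lie x y l : aff_loop [lie x, y] l =
  \sum_(i <- finsupp (aff_loop x)) [lie aff_loop x i, aff_loop y (l - i)]
  + (aff_dd x * l%:~R) *: aff_loop y l - (aff_dd y * l%:~R) *: aff_loop x l.
Proof.
have loopN f i : (- f) i = - f i by rewrite -scaleN1r loopZ scaleN1r.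
by rewrite /= !loopD loopN !loopZ loop_bracketE !loop_derivE !scalerA.
Qed.

Lemma aff_loopL a x y l : aff_loop (a *: x + y) l = a *: aff_loop x l + aff_loop y l.
Proof. by rewrite /= loopD loopZ. Qed.

(** The common shape of the affine parabolics: positive degrees are unrestricted, as
    they belong to the affine Borel subalgebra, and no degree below [-1] occurs. *)
Definition graded_par (V1 V0 : set g) : set aff :=
  [set x | [/\ (forall i : int, i < -1 -> aff_loop x i = 0),
               V1 (aff_loop x (-1)) & V0 (aff_loop x 0)]].

(** The last three conditions control the products that involve degree [-1]: in
    degree 0 they meet the arbitrary components of degree 1, and the vanishing of
    the last one leaves nothing in degree [-2]. *)
Lemma graded_par_subalgebra V1 V0 : is_subspace V1 -> is_subalgebra V0 ->
  (forall u v, V0 u -> V1 v -> V1 [lie u, v]) ->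
  (forall u v, V1 u -> V0 [lie u, v]) ->
  (forall u v, V1 u -> V1 v -> [lie u, v] = 0) ->
  is_subalgebra (graded_par V1 V0).
Proof.
move=> s1 [s0 V00] V01 V1g V11; split.
  split.
    by split=> [i _||]; rewrite /= loop0 //; [case: s1|case: s0].
  move=> a x y [xlow x1 x0] [ylow y1 y0]; split=> [i i1||]; rewrite aff_loopL.
  - by rewrite xlow // ylow // scaler0 addr0.
  - by case: s1 => _; apply.
  - by case: s0 => _; apply.
move=> x y [xlow x1 x0] [ylow y1 y0].
have V10 u v : V1 u -> V0 v -> V1 [lie u, v].
  by move=> u1 v0; rewrite lie_anticomm; apply: is_subspaceN => //; apply: V01.
have Vg1 u v : V1 v -> V0 [lie u, v].
  by move=> v1; rewrite lie_anticomm; apply: is_subspaceN => //; apply: V1g.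
have V10' : V1 0 by case: s1.
have V00' : V0 0 by case: s0.
split=> [l l1||]; rewrite aff_loop_lie.
- rewrite xlow // ylow // !scaler0 addr0 subr0 big1 // => i _.
  have [i1|i1] : i < -1 \/ -1 <= i by lia.
    by rewrite xlow // lie0l.
  have [li|li] : l - i < -1 \/ l - i = -1 /\ i = -1 by lia.
    by rewrite ylow // lie0r.
  by case: li => -> ->; apply: V11.
- apply: is_subspaceB => //; last by apply: is_subspaceZ.
  apply: is_subspaceD => //; last by apply: is_subspaceZ.
  apply: is_subspace_sum => // i _.
  have [i1|[->|[->|i1]]] : i < -1 \/ i = -1 \/ i = 0 \/ 0 < i by lia.
  + by rewrite xlow // lie0l.
  + by rewrite subrr; apply: V10.
  + by rewrite subr0; apply: V01.
  + by rewrite ylow ?lie0r //; lia.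
- apply: is_subspaceB => //; last by apply: is_subspaceZ.
  apply: is_subspaceD => //; last by apply: is_subspaceZ.
  apply: is_subspace_sum => // i _.
  have [i1|[->|[->|[->|i1]]]] : i < -1 \/ i = -1 \/ i = 0 \/ i = 1 \/ 1 < i by lia.
  + by rewrite xlow // lie0l.
  + exact: V1g.
  + by rewrite subr0; apply: V00.
  + exact: Vg1.
  + by rewrite ylow ?lie0r //; lia.
Qed.

(** What remains after removing the components in degrees [-1] and 0 is in the
    positive part, which belongs to every affine parabolic. *)
Lemma graded_par_decomp V1 V0 x : graded_par V1 V0 x ->
  aff_positive_part (x - (aff_t (-1) (aff_loop x (-1)) + aff_t 0 (aff_loop x 0)
      + aff_c x *: aff_C k r + aff_dd x *: aff_d k r)).
Proof.
move=> [xlow _ _]; split=> [||i i0] /=.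
- by rewrite !mulr0 mulr1 !add0r addr0 subrr.
- by rewrite !mulr0 mulr1 !add0r subrr.
- rewrite loopD -scaleN1r loopZ !loopD !loopZ !loop0 !monoE !scaler0 !addr0.
  have [i1|[->|->]] : i < -1 \/ i = -1 \/ i = 0 by lia.
  + have [-> ->] : (i == -1) = false /\ (i == 0) = false by lia.
    by rewrite xlow // addr0 scaler0 addr0.
  + by rewrite eqxx /= addr0 scaleN1r subrr.
  + by rewrite eqxx /= add0r scaleN1r subrr.
Qed.

Lemma graded_par_sub V1 V0 (W : set aff) : is_subspace W ->
  aff_t (-1) @` V1 `<=` W -> aff_t 0 @` V0 `<=` W ->
  W (aff_C k r) -> W (aff_d k r) -> aff_positive_part `<=` W ->
  graded_par V1 V0 `<=` W.
Proof.
move=> sW W1 W0 WC Wd Wpos x /[dup] /graded_par_decomp /Wpos Wu [_ x1 x0].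
rewrite -[x](subrK (aff_t (-1) (aff_loop x (-1)) + aff_t 0 (aff_loop x 0)
      + aff_c x *: aff_C k r + aff_dd x *: aff_d k r)).
apply: is_subspaceD => //; do ![apply: is_subspaceD => //].
- by apply: W1; exists (aff_loop x (-1)).
- by apply: W0; exists (aff_loop x 0).
- exact: is_subspaceZ.
- exact: is_subspaceZ.
Qed.

End LoopGrading.

(** * Elements of the affine Borel subalgebra *)

Section AffineBorel.
Context {k : fieldType} {r : nat}.
Variables (t b : set (sl k r)).
Hypotheses (t0 : t 0) (b0 : b 0).

Lemma aff_t_0 i : aff_t i (0 : sl k r) = 0.
Proof. by rewrite /aff_t mono0. Qed.

Let t00 : (aff_t 0 @` t) 0. Proof. by exists 0 => //; rewrite aff_t_0. Qed.

Lemma aff_cartan_t x : t x -> aff_cartan t (aff_t 0 x).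
Proof. by move=> tx; do 2![apply: set_addl; first exact: line0]; exists x. Qed.

Lemma aff_cartan_C : aff_cartan t (aff_C k r).
Proof.
by apply: set_addl (line0 _) _; apply: set_addr t00 _; apply: line_id.
Qed.

Lemma aff_cartan_d : aff_cartan t (aff_d k r).
Proof.
by apply: set_addr (line_id _); apply: set_addl t00; apply: line0.
Qed.

Let cartan0 : aff_cartan t 0.
Proof. by rewrite -(aff_t_0 0); apply: aff_cartan_t. Qed.

Let pos0 : aff_positive_part (0 : affine k r).
Proof. by split=> // i _; rewrite /= loop0. Qed.

Let b00 : (aff_t 0 @` b) 0. Proof. by exists 0 => //; rewrite aff_t_0. Qed.

Lemma aff_borel_b x : b x -> aff_borel t b (aff_t 0 x).
Proof. by move=> bx; apply: set_addl pos0 _; apply: set_addl cartan0 _; exists x. Qed.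

Lemma aff_borel_cartan x : aff_cartan t x -> aff_borel t b x.
Proof. by move=> tx; apply: set_addl pos0 _; apply: set_addr b00 _. Qed.

Lemma aff_borel_pos x : aff_positive_part x -> aff_borel t b x.
Proof. by move=> px; apply: set_addr px; apply: set_addl b00; apply: cartan0. Qed.

End AffineBorel.

(** * The involution on each degree *)

Section Omega.
Context {k : fieldType} {r : nat}.
Local Notation g := (sl k r).
Local Notation aff := (affine k r).
Local Notation I := 'I_r.+1.
Variables (t : set g) (omega : aff -> aff).
Hypothesis omegaP : is_omega t omega.
Hypothesis t0 : t 0.

(** As [omega] maps [g t^i] to [g t^-i], it is given by a linear map of [g] in each
    degree; that of degree 0 is an involution of the Lie algebra [g]. *)
Definition omega_t (i : int) (x : g) : g := aff_loop (omega (aff_t i x)) (- i).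
Local Notation sigma := (omega_t 0).

Lemma omega_aff_t i x : omega (aff_t i x) = aff_t (- i) (omega_t i x).
Proof.
case: omegaP => _ _ _ _ /(_ i) om.
have : [set aff_t (- i) u | u in [set: g]] (omega (aff_t i x)).
  by rewrite -om; exists (aff_t i x) => //; exists x.
by move=> [y _ yE]; rewrite /omega_t -yE /= monoE eqxx.
Qed.

Lemma omega_linear a x y : omega (a *: x + y) = a *: omega x + omega y.
Proof. by case: omegaP => om _ _ _ _; rewrite om. Qed.

Lemma omega_t_linear i a x y :
  omega_t i (a *: x + y) = a *: omega_t i x + omega_t i y.
Proof. by rewrite /omega_t aff_t_linear omega_linear aff_loopL. Qed.

Lemma omega_t0 i : omega_t i 0 = 0.
Proof.
by have := omega_t_linear i (-1) 0 0; rewrite scaler0 addr0 scaleN1r addNr.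
Qed.

Lemma omega_C : omega (aff_C k r) = - aff_C k r.
Proof.
by case: omegaP => _ _ _ + _; apply; apply: aff_cartan_C.
Qed.

Lemma omega_d : omega (aff_d k r) = - aff_d k r.
Proof.
by case: omegaP => _ _ _ + _; apply; apply: aff_cartan_d.
Qed.

Lemma omega_loop x (i : int) : aff_loop (omega x) i = omega_t (- i) (aff_loop x (- i)).
Proof.
elim/aff_ind: x => [a x y IHx IHy|j x| |].
- by rewrite omega_linear !aff_loopL IHx IHy omega_t_linear.
- rewrite omega_aff_t /= !monoE eqr_oppLR.
  by case: eqP => [->|_]; rewrite ?opprK ?omega_t0.
- by rewrite omega_C /= loop0 omega_t0 -scaleN1r loopZ loop0 scaler0.
- by rewrite omega_d /= loop0 omega_t0 -scaleN1r loopZ loop0 scaler0.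
Qed.

Lemma omegaK x : omega (omega x) = x.
Proof. by case: omegaP. Qed.

Lemma sigmaE x : omega (aff_t 0 x) = aff_t 0 (sigma x).
Proof. by rewrite omega_aff_t oppr0. Qed.

Lemma aff_t_inj i : injective (@aff_t k r i).
Proof.
by move=> x y /(congr1 (fun u => aff_loop u i)); rewrite /= !monoE eqxx.
Qed.

Lemma sigmaK x : sigma (sigma x) = x.
Proof. by apply: (aff_t_inj (i := 0)); rewrite -!sigmaE omegaK. Qed.

Lemma aff_t_lie0 (x : g) i y : [lie aff_t 0 x, aff_t i y] = aff_t i [lie x, y].
Proof.
have := aff_bracket_tt 0 x i y.
by rewrite /aff_bracket_mono mulr0 mul0r scale0r addr0 add0r.
Qed.

Lemma sigma_lie x y : sigma [lie x, y] = [lie sigma x, sigma y].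
Proof.
apply: (aff_t_inj (i := 0)); rewrite -sigmaE -!aff_t_lie0 -!sigmaE.
by case: omegaP => _ om _ _ _; rewrite om.
Qed.

Lemma sigma_t x : t x -> sigma x = - x.
Proof.
move=> tx; apply: (aff_t_inj (i := 0)); rewrite -sigmaE -scaleN1r aff_tZ scaleN1r.
by case: omegaP => _ _ _ + _; apply; apply: aff_cartan_t.
Qed.

End Omega.

(** * The involution as a transposition of supports *)

Section OmegaInCoordinates.
Context {k : fieldType} {r : nat}.
Local Notation g := (sl k r).
Local Notation aff := (affine k r).
Local Notation I := 'I_r.+1.
Variable P : 'M[k]_r.+1.
Hypothesis Pu : P \in unitmx.
Hypothesis chark : [pchar k] =i pred0.
Local Notation m := (mxcoord P).
Local Notation E := (elt P).
Local Notation t := (coord_supp P eq_op).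
Variable omega : aff -> aff.
Hypothesis omegaP : is_omega t omega.
Local Notation sigma := (omega_t omega 0).

Let t0 : t 0. Proof. by case: (supp_subspace P eq_op). Qed.

(** The involution is [-1] on the diagonal subalgebra, so it maps a weight space
    to that of the opposite weight. *)
Lemma sigma_elt i j : i != j -> exists c, sigma (E i j) = c *: E j i.
Proof.
move=> ij; have ji : j != i by rewrite eq_sym.
exists (m (sigma (E i j)) j i); apply: (rt_spaceP Pu chark) => // -[h ht] /=.
have th := set_mem ht.
have := congr1 (fun y => sigma y) (rt_space Pu ij (exist _ h ht)) => /=.
rewrite (sigma_lie omegaP) (sigma_t omegaP) // lieNl -[_ *: E i j]addr0.
rewrite (omega_t_linear omegaP) (omega_t0 omegaP) addr0 => /(congr1 -%R).
by rewrite opprK -scaleNr /rt /= opprB.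
Qed.

Lemma sigma_supp (R : rel I) x :
  coord_supp P R x -> coord_supp P (fun i j => R j i) (sigma x).
Proof.
move=> Rx.
suff sx i j : exists c, m (sigma x) j i = c * m x i j.
  by move=> j i; have [c ->] := sx i j; rewrite mulf_eq0 negb_or => /andP[_ /Rx].
have [d Dd xE] := mxcoord_diag_decomp Pu x.
have sumL (s : seq (I * I)) Q (F : I * I -> g) :
    sigma (\sum_(p <- s | Q p) F p) = \sum_(p <- s | Q p) sigma (F p).
  apply: big_morph; last exact: (omega_t0 omegaP).
  by move=> u v; rewrite -[u]scale1r (omega_t_linear omegaP) !scale1r.
have sE : m (sigma x) j i = - m d j i +
    \sum_(p : I * I | p.1 != p.2) m x p.1 p.2 * m (sigma (E p.1 p.2)) j i.
  rewrite [in LHS]xE -[d]scale1r (omega_t_linear omegaP) sumL scale1r (sigma_t omegaP) //.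
  rewrite scale1r mxcoordDE mxcoordNE mxcoord_sumE; congr (_ + _); apply: eq_bigr => p _.
  by rewrite -[_ *: E _ _]addr0 (omega_t_linear omegaP) (omega_t0 omegaP) addr0 mxcoordZE.
have [ij|ij] := eqVneq i j.
  exists (-1); rewrite sE big1 ?addr0; last first.
    move=> [a c] /= ac; have [e ->] := sigma_elt ac.
    rewrite mxcoordZE (mxcoordEE Pu); last by rewrite eq_sym.
    case: (eqVneq j c) => [jc|]; case: (eqVneq i a) => [ia|]; rewrite /= ?mulr0 //.
    by move: ac; rewrite -jc -ia ij eqxx.
  rewrite mulN1r; congr (- _); rewrite xE mxcoordDE mxcoord_sumE big1 ?addr0 ?ij //.
  move=> [a c] /= ac; rewrite mxcoordZE (mxcoordEE Pu) //.
  case: (eqVneq j a) => [ja|]; case: (eqVneq j c) => [jc|]; rewrite /= ?mulr0 //.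
  by move: ac; rewrite -jc -ja eqxx.
exists (m (sigma (E i j)) j i); rewrite sE [m d j i](_ : _ = 0) ?oppr0 ?add0r; last first.
  by apply/eqP; apply: contraNT ij => /Dd; rewrite eq_sym.
rewrite (bigD1 (i, j)) //= big1 ?addr0 1?mulrC // => -[a c] /= /andP[ac neq].
have [e ->] := sigma_elt ac; rewrite mxcoordZE (mxcoordEE Pu); last by rewrite eq_sym.
move: neq; rewrite xpair_eqE (eq_sym a) (eq_sym c) andbC.
by move=> /negPf->; rewrite /= !mulr0.
Qed.

Lemma sigma_suppP (R : rel I) x :
  coord_supp P R (sigma x) <-> coord_supp P (fun i j => R j i) x.
Proof.
split=> [Rx|/sigma_supp//].
by rewrite -(sigmaK omegaP x); apply: (sigma_supp (R := R)).
Qed.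

End OmegaInCoordinates.

(** * The direct and semi-direct sums *)

Section DirectSums.
Context {k : fieldType} {r : nat}.
Local Notation g := (sl k r).
Local Notation aff := (affine k r).
Implicit Types (q z : set g).

Lemma is_direct_subalgebra (L : lieAlgType k) (A B : set L) :
  is_direct A B -> is_subalgebra (set_add A B).
Proof.
move=> [[sA AA] [sB BB] _ AB]; split; first exact: set_add_subspace.
move=> _ _ [x Ax [y By <-]] [x' Ax' [y' By' <-]].
exists [lie x, x']; first exact: AA.
exists [lie y, y']; first exact: BB.
by rewrite lieDl !lieDr (AB x y') // (lie_anticomm y x') (AB x' y) // oppr0 addr0 add0r.
Qed.

Lemma lie_d0 (x : g) : [lie aff_t 0 x, aff_d k r] = 0.
Proof. by have := aff_bracket_td 0 x; rewrite scale0r oppr0. Qed.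

Lemma aff_t0_subalgebra q : is_subalgebra q -> is_subalgebra (aff_t 0 @` q).
Proof.
move=> [[q0 qL] qq]; split; first split.
- by exists 0 => //; rewrite aff_t_0.
- move=> a _ _ [x qx <-] [y qy <-]; exists (a *: x + y); first exact: qL.
  by rewrite aff_t_linear.
- move=> _ _ [x qx <-] [y qy <-]; exists [lie x, y]; first exact: qq.
  by rewrite aff_t_lie0.
Qed.

(** A coordinate [F] that vanishes on [A] and is injective on the line separates
    them. *)
Lemma line_meet (A : set aff) (F : aff -> k) (v : aff) : is_subspace A ->
  (forall a, F (a *: v) = a) -> (forall x, A x -> F x = 0) ->
  A `&` line v = [set 0].
Proof.
move=> [A0 _] Fv FA; apply/seteqP; split=> [x [/FA Fx [a _ ax]]|_ ->].
  by move: Fx; rewrite -ax Fv => ->; rewrite scale0r.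
by split=> //; exists 0; rewrite ?scale0r.
Qed.

Lemma direct_d q : is_subalgebra q -> is_direct (aff_t 0 @` q) (line (aff_d k r)).
Proof.
move=> sq; have sq0 := aff_t0_subalgebra sq.
split=> //; [exact: line_subalgebra| |].
  apply: (line_meet (F := @aff_dd k r)); first by case: sq0.
    by move=> a; rewrite /= mulr1.
  by move=> _ [x _ <-].
by move=> _ _ [x _ <-] [a _ <-]; rewrite lieZr lie_d0 scaler0.
Qed.

Lemma direct_C q : is_subalgebra q ->
  is_direct (set_add (aff_t 0 @` q) (line (aff_d k r))) (line (aff_C k r)).
Proof.
move=> sq; have sqd := is_direct_subalgebra (direct_d sq).
split=> //; [exact: line_subalgebra| |].
  apply: (line_meet (F := @aff_c k r)); first by case: sqd.
    by move=> a; rewrite /= mulr1.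
  by move=> _ [_ [x _ <-] [_ [a _ <-] <-]]; rewrite /= mulr0 addr0.
move=> x _ _ [a _ <-]; rewrite lieZr.
by rewrite [bracket x _](aff_bracketCr x) scaler0.
Qed.

(** The cocycle pairs degree [i] with degree [-i] and has the factor [i], so it does
    not contribute between the degrees [-1] and 0 or inside them. *)
Lemma semidirect_tinv q z : is_subalgebra q -> is_subspace z ->
  (forall x y, q x -> z y -> z [lie x, y]) ->
  (forall x y, z x -> z y -> [lie x, y] = 0) ->
  is_semidirect (set_add (set_add (aff_t 0 @` q) (line (aff_d k r)))
                         (line (aff_C k r))) (aff_t (-1) @` z).
Proof.
move=> sq [z0 zL] qz zz.
have sz : is_subspace (aff_t (-1) @` z).
  split; first by exists 0; rewrite // aff_t_0.
  move=> a _ _ [x zx <-] [y zy <-]; exists (a *: x + y); first exact: zL.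
  by rewrite aff_t_linear.
have sqdC := is_direct_subalgebra (direct_C sq).
split=> //.
- split=> // _ _ [x zx <-] [y zy <-].
  have -> : [lie aff_t (-1) x, aff_t (-1) y] = 0 :> aff.
    have := aff_bracket_tt (-1) x (-1) y.
    by rewrite /aff_bracket_mono zz // aff_t_0 mul0r mul0r scale0r addr0.
  by case: sz.
- apply/seteqP; split=> [v [+ [y zy yv]]|_ ->]; last first.
    by split; [case: sqdC => -[]|case: sz].
  rewrite -yv {v yv}; move=> [_ [_ [x qx <-] [_ [a _ <-] <-]] [_ [c _ <-]]].
  move=> /(congr1 (fun u => aff_loop u (-1))) /=.
  rewrite !loopD !loopZ !loop0 !monoE /= !scaler0 !addr0 => <-.
  by rewrite aff_t_0.
- move=> _ _ [_ [_ [x qx <-] [_ [a _ <-] <-]] [_ [c _ <-] <-]] [y zy <-].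
  rewrite !lieDl !lieZl aff_t_lie0 [bracket (aff_C k r) _](aff_bracketCl (aff_t (-1) y)).
  rewrite [bracket (aff_d k r) _](aff_bracket_dt (-1) y) scaler0 addr0 -!aff_tZ -aff_tD.
  exists ([lie x, y] + a *: ((-1)%:~R *: y)) => //.
  have sz' : is_subspace z by split.
  by apply: is_subspaceD => //; [exact: qz|do 2!apply: is_subspaceZ => //].
Qed.

(** In this form the sum can be compared with an affine seaweed degree by
    degree. *)
Lemma two_graded_sum q z x :
  set_add (set_add (set_add (aff_t 0 @` q) (line (aff_d k r))) (line (aff_C k r)))
    (aff_t (-1) @` z) x <->
  [/\ forall i : int, i != 0 -> i != -1 -> aff_loop x i = 0,
      z (aff_loop x (-1)) & q (aff_loop x 0)].
Proof.
split=> [|[xoff x1 x0]].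
  move=> [_ [_ [_ [u qu <-] [_ [a _ <-] <-]] [_ [c _ <-] <-]] [_ [y zy <-] <-]].
  split=> [i i0 i1||] /=; rewrite !loopD !loopZ !loop0 !monoE ?(negPf i0) ?(negPf i1) /=;
    by rewrite ?scaler0 !(addr0, add0r).
exists (aff_t 0 (aff_loop x 0) + aff_dd x *: aff_d k r + aff_c x *: aff_C k r).
  exists (aff_t 0 (aff_loop x 0) + aff_dd x *: aff_d k r).
    exists (aff_t 0 (aff_loop x 0)); first by exists (aff_loop x 0).
    by exists (aff_dd x *: aff_d k r) => //; exists (aff_dd x).
  by exists (aff_c x *: aff_C k r) => //; exists (aff_c x).
exists (aff_t (-1) (aff_loop x (-1))); first by exists (aff_loop x (-1)).
case: x xoff {x1 x0} => f c a xoff; congr Affine; rewrite /= ?mulr0 ?mulr1 ?addr0 ?add0r //.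
apply/fsfunP => i; rewrite !loopD !loopZ !loop0 !monoE !scaler0 !addr0.
case: (eqVneq i 0) => [->|i0]; first by rewrite /= addr0.
by case: (eqVneq i (-1)) => [->|i1]; rewrite add0r //; apply/esym/xoff.
Qed.

End DirectSums.

(** * Parabolics generated by simple roots *)

Section AffineParabolicsInCoordinates.
Context {k : fieldType} {r : nat}.
Local Notation g := (sl k r).
Local Notation aff := (affine k r).
Local Notation I := 'I_r.+1.
Variable P : 'M[k]_r.+1.
Hypothesis Pu : P \in unitmx.
Hypothesis chark : [pchar k] =i pred0.
Local Notation m := (mxcoord P).
Local Notation E := (elt P).
Local Notation t := (coord_supp P eq_op).
Local Notation b := (coord_supp P upper_rel).
Local Notation lambda := (@rt k r P ord0 ord_max).
Variable e : (t -> k) -> g.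
Hypothesis eP : root_vectors e.
Implicit Types (T : set (aff_weight t)).

(** The index [l] stands for the simple root [eps_l - eps_(l+1)]. *)
Definition simple_idx T : pred nat := fun l =>
  `[< exists i j : I, [/\ i = l :> nat, j = l.+1 :> nat & T (rt i j, 0)] >].

(** Counts block boundaries: two indices are in the same diagonal block of the
    parabolic of [T] when their counts agree. *)
Definition cuts T (n : nat) : nat := (\sum_(l < n) ~~ simple_idx T l)%N.

Lemma cutsS T n : cuts T n.+1 = (cuts T n + ~~ simple_idx T n)%N.
Proof. exact: big_ord_recr. Qed.

Lemma cuts_mono T : {homo cuts T : i j / (i <= j)%N}.
Proof.
move=> i j /subnK <-; elim: (j - i)%N => [|n IHn]; first by rewrite add0n.
by apply: leq_trans IHn _; rewrite addSn cutsS leq_addr.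
Qed.

Lemma cuts_eq T (i j : I) : T (rt i j, 0) -> j = i.+1 :> nat -> cuts T i = cuts T j.
Proof.
move=> Tij ji; rewrite ji cutsS; have -> : simple_idx T i by apply/asboolP; exists i, j.
by rewrite addn0.
Qed.

Lemma cuts_eqP T (i j : I) : j = i.+1 :> nat -> cuts T j = cuts T i -> T (rt i j, 0).
Proof.
move=> ji; rewrite ji cutsS -[RHS]addn0 => /addnI/eqP; rewrite eqb0 negbK.
move=> /asboolP[i' [j' [ii jj]]].
have -> : i' = i by apply: val_inj.
by have -> : j' = j by apply: val_inj; rewrite /= jj ji.
Qed.

Lemma cuts_gt0 T (i j : I) : j = i.+1 :> nat -> ~ T (rt i j, 0) ->
  (cuts T 0 < cuts T r)%N.
Proof.
move=> ji Tij; apply: (@leq_trans (cuts T j)); last by apply: cuts_mono; rewrite -ltnS.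
apply: (@leq_ltn_trans (cuts T i)); first exact: cuts_mono.
rewrite ltn_neqAle; apply/andP; split; last by apply: cuts_mono; rewrite ji.
by apply/eqP => cij; apply: Tij; apply: cuts_eqP.
Qed.

Lemma simple_rootsP T w : T `<=` simple_roots b -> T w ->
  exists i j : I, [/\ j = i.+1 :> nat, i != j & w = (rt i j, 0)].
Proof.
move=> Tb /Tb [a /(is_simpleP Pu chark)[i [j [ji ->]]] <-]; exists i, j; split=> //.
by rewrite -val_eqE /= ji; lia.
Qed.

Lemma succ_neq (i j : I) : j = i.+1 :> nat -> i != j.
Proof. by rewrite -val_eqE /= => ->; lia. Qed.

Lemma neg_root_par T w : T `<=` simple_roots b -> T w ->
  par P (cuts T) (e (\- w.1)).
Proof.
move=> Tb Tw; have [i [j [ji ij wE]]] := simple_rootsP Tb Tw.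
have ji' : j != i by rewrite eq_sym.
have sp : is_subspace (par P (cuts T)) by apply: supp_subspace.
rewrite wE /= rtN; have [c _ ->] := root_vectorP Pu chark eP ji'.
refine (is_subspaceZ _ sp _); apply/(suppE Pu) => //.
by rewrite /flag_rel /level addn0 (cuts_eq (j := j)) // -wE.
Qed.

Lemma par_sub_gen T (V : set g) : is_subalgebra V -> b `<=` V ->
  (forall w, T w -> V (e (\- w.1))) -> par P (cuts T) `<=` V.
Proof.
move=> sV bV TV; apply: (par_sub Pu) => //; first exact: cuts_mono.
move=> i j ij /(cuts_eqP ij) /TV /=; rewrite rtN.
have nij : i != j by rewrite eq_sym succ_neq.
have [c c0 ->] := root_vectorP Pu chark eP nij.
by apply: is_subspaceVZ => //; case: sV.
Qed.

Lemma parabolic_par T : T `<=` simple_roots b -> parabolic b e T = par P (cuts T).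
Proof.
move=> Tb; apply/seteqP; split.
  apply: lie_gen_sub; first exact: par_subalgebra.
  rewrite subUset; split; first by apply: upper_par; apply: cuts_mono.
  by move=> _ [w Tw <-]; apply: neg_root_par.
apply: par_sub_gen; first exact: lie_gen_subalgebra.
  by move=> x bx; apply: sub_lie_gen; left.
by move=> w Tw; apply: sub_lie_gen; right; exists w.
Qed.

Variable omega : aff -> aff.
Hypothesis omegaP : is_omega t omega.

Lemma opposite_borelE : opposite_borel b omega = coord_supp P lower_rel.
Proof.
have t0 : t 0 by case: (supp_subspace P eq_op).
apply/seteqP; split=> x.
  move=> [_ [y by_ <-] /=]; rewrite (sigmaE omegaP) => /aff_t_inj <-.
  by apply: (sigma_supp Pu chark omegaP (R := upper_rel)).
move=> bx; exists (aff_t 0 (omega_t omega 0 x)); last first.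
  by rewrite (sigmaE omegaP) (sigmaK omegaP).
by exists (omega_t omega 0 x) => //; apply/(sigma_suppP Pu chark omegaP).
Qed.

Lemma opposite_parabolicE T : T `<=` simple_roots b ->
  opposite_parabolic b e omega T = par_opp P (cuts T).
Proof.
move=> Tb; rewrite /opposite_parabolic opposite_borelE; apply/seteqP; split.
  apply: lie_gen_sub; first exact: par_opp_subalgebra.
  rewrite subUset; split; first by apply: lower_par_opp; apply: cuts_mono.
  move=> _ [w Tw <-]; have [i [j [ji ij wE]]] := simple_rootsP Tb Tw.
  have sp : is_subspace (par_opp P (cuts T)) by apply: supp_subspace.
  rewrite wE /=; have [c _ ->] := root_vectorP Pu chark eP ij.
  refine (is_subspaceZ _ sp _); apply/(suppE Pu) => //.
  by rewrite (cuts_eq (j := j)) // -wE.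
have sV := lie_gen_subalgebra (coord_supp P lower_rel `|` [set e w.1 | w in T]).
apply: (par_opp_sub Pu) => //; first exact: cuts_mono.
  by move=> x bx; apply: sub_lie_gen; left.
move=> i j ij /(cuts_eqP ij) Tji.
have nji : j != i by apply: succ_neq.
have [c c0 ec] := root_vectorP Pu chark eP nji.
refine (is_subspaceVZ sV.1 c0 _).
by rewrite -ec; apply: sub_lie_gen; right; exists (rt j i, 0).
Qed.

(** The inclusion from left to right holds on generators; in the other direction
    only the degrees [-1] and 0 need an argument. *)
Lemma aff_parabolicE T (V1 V0 : set g) :
  is_subalgebra (graded_par V1 V0) -> V1 0 -> is_subspace V0 -> b `<=` V0 ->
  aff_neg_vector e @` T `<=` graded_par V1 V0 ->
  aff_t (-1) @` V1 `<=` aff_parabolic b e T ->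
  aff_t 0 @` V0 `<=` aff_parabolic b e T ->
  aff_parabolic b e T = graded_par V1 V0.
Proof.
move=> sG V10 sV0 bV0 TG W1 W0.
have tb : t `<=` b by apply: suppS => i j /eqP->; rewrite /upper_rel.
have GC : graded_par V1 V0 (aff_C k r).
  by split=> [i _||]; rewrite /= loop0 //; case: sV0.
have Gd : graded_par V1 V0 (aff_d k r).
  by split=> [i _||]; rewrite /= loop0 //; case: sV0.
have G0 x : V0 x -> graded_par V1 V0 (aff_t 0 x).
  by move=> V0x; split=> [i i1||]; rewrite /= monoE // ifF //; lia.
have sW := lie_gen_subalgebra (aff_borel t b `|` aff_neg_vector e @` T).
have addG x y : graded_par V1 V0 x -> graded_par V1 V0 y -> graded_par V1 V0 (x + y).
  by case: sG => sG _; apply: is_subspaceD.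
have scaleG a x : graded_par V1 V0 x -> graded_par V1 V0 (a *: x).
  by case: sG => sG _; apply: is_subspaceZ.
apply/seteqP; split.
  apply: lie_gen_sub => //; rewrite subUset; split=> // v.
  move=> [_ [_ [x bx <-] [_ [_ [_ [h th <-] [_ [a _ <-] <-]] [_ [c _ <-] <-]] <-]] [u [_ _ upos] <-]].
  have ux : graded_par V1 V0 u.
    by split=> [i i1||]; rewrite upos //; first [by lia|case: sV0].
  apply: (addG) => //; apply: (addG); first exact/G0/bV0.
  by apply: (addG); [apply: (addG); [exact/G0/bV0/tb|exact: scaleG]|exact: scaleG].
have b0 : b 0 by case: (supp_subspace P upper_rel).
have t0 : t 0 by case: (supp_subspace P eq_op).
have borelW x : aff_borel t b x -> aff_parabolic b e T x.
  by move=> bx; apply: sub_lie_gen; left.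
apply: graded_par_sub => //; first by case: sW.
- by apply: borelW; apply: aff_borel_cartan => //; apply: aff_cartan_C.
- by apply: borelW; apply: aff_borel_cartan => //; apply: aff_cartan_d.
- by move=> u upos; apply: borelW; apply: aff_borel_pos.
Qed.

End AffineParabolicsInCoordinates.

(** * Affine parabolics and seaweeds *)

Section SeaweedsInCoordinates.
Context {k : fieldType} {r : nat}.
Local Notation g := (sl k r).
Local Notation aff := (affine k r).
Local Notation I := 'I_r.+1.
Variable P : 'M[k]_r.+1.
Hypothesis Pu : P \in unitmx.
Hypothesis chark : [pchar k] =i pred0.
Local Notation E := (elt P).
Local Notation t := (coord_supp P eq_op).
Local Notation b := (coord_supp P upper_rel).
Local Notation lambda := (@rt k r P ord0 ord_max).
Variable e : (t -> k) -> g.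
Hypothesis eP : root_vectors e.
Variable omega : aff -> aff.
Hypothesis omegaP : is_omega t omega.
Implicit Types (S T : set (aff_weight t)).

Lemma set0_subspace : is_subspace [set (0 : g)].
Proof. by split=> // a _ _ -> ->; rewrite scaler0 addr0. Qed.

(** In degree 0 the affine bracket is that of [g], so the finite generators
    produce the finite parabolic inside the affine one. *)
Lemma parabolic_t0 T S : S `&` simple_roots b = T ->
  aff_t 0 @` par P (cuts T) `<=` aff_parabolic b e S.
Proof.
move=> ST _ [x + <-].
have [sW WW] := lie_gen_subalgebra (aff_borel t b `|` aff_neg_vector e @` S).
have t0 : t 0 by case: (supp_subspace P eq_op).
suff: par P (cuts T) `<=` aff_t 0 @^-1` aff_parabolic b e S by apply.
apply: (par_sub_gen Pu chark eP).
- split; first split.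
  + by rewrite /preimage /= aff_t_0; case: sW.
  + by move=> a y z Wy Wz; rewrite /preimage /= aff_t_linear; case: sW => _; apply.
  + by move=> y z Wy Wz; rewrite /preimage /= -aff_t_lie0; apply: WW.
- by move=> y by_; apply: sub_lie_gen; left; apply: aff_borel_b.
- move=> w; rewrite -ST => -[Sw [a _ wE]]; apply: sub_lie_gen; right.
  by exists w => //; rewrite /aff_neg_vector -wE /= oppr0.
Qed.

Lemma neg_vector_t0 T w : T `<=` simple_roots b -> T w ->
  aff_neg_vector e w = aff_t 0 (e (\- w.1)).
Proof. by move=> Tb /Tb[a _ <-]; rewrite /aff_neg_vector /= oppr0. Qed.

Lemma graded_par_t0 (V1 V0 : set g) x : V1 0 -> V0 x -> graded_par V1 V0 (aff_t 0 x).
Proof. by move=> V10 V0x; split=> [i i1||]; rewrite /= monoE // ifF //; lia. Qed.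

(** All the generators have degree at least 0, and everything in positive degree
    belongs to the affine Borel subalgebra, so only degree 0 depends on [T]. *)
Lemma aff_parabolic_finite T : T `<=` simple_roots b ->
  aff_parabolic b e T = graded_par [set 0] (par P (cuts T)).
Proof.
move=> Tb; apply: (aff_parabolicE Pu) => //.
- apply: graded_par_subalgebra; [exact: set0_subspace|exact: par_subalgebra| | |].
  + by move=> x _ _ ->; rewrite /= lie0r.
  + by move=> _ y ->; rewrite lie0l; case: (supp_subspace P (flag_rel (level (cuts T)) 0)).
  + by move=> _ y -> _; rewrite lie0l.
- exact: supp_subspace.
- by apply: upper_par; apply: cuts_mono.
- move=> _ [w Tw <-]; rewrite (neg_vector_t0 Tb) //; apply: graded_par_t0 => //.
  exact: (neg_root_par Pu chark eP).
- move=> _ [_ -> <-]; rewrite aff_t_0.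
  by have [[]] := lie_gen_subalgebra (aff_borel t b `|` aff_neg_vector e @` T).
- by apply: parabolic_t0; apply/seteqP; split=> [w []//|w Tw]; split=> //; apply: Tb.
Qed.

(** With the affine root, and as soon as some finite simple root is missing, the
    component of degree [-1] is the corner block: it is generated by
    [e_lambda t^-1] under the finite parabolic. *)
Lemma aff_parabolic_affine S (T := S `&` simple_roots b) :
  S `<=` aff_simple_roots b lambda -> S (alpha0 lambda) ->
  (cuts T 0 < cuts T r)%N ->
  aff_parabolic b e S = graded_par (corner P (cuts T)) (par P (cuts T)).
Proof.
move=> Sb S0 cutT; have Tmono := @cuts_mono _ _ P T.
have or : ord0 != ord_max :> I.
  by apply/eqP => /(congr1 val) /= r0; move: cutT; rewrite -[X in (_ < cuts _ X)%N]r0 ltnn.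
have [c c0 ec] := root_vectorP Pu chark eP or.
have nlam : \- \- lambda = lambda by rewrite !rtN.
have sW := lie_gen_subalgebra (aff_borel t b `|` aff_neg_vector e @` S).
have sC := supp_subspace P (fun i j : I => (cuts T i <= cuts T 0)%N && (cuts T r <= cuts T j)%N).
have Tb : T `<=` simple_roots b by move=> w [].
apply: (aff_parabolicE Pu).
- apply: graded_par_subalgebra => //; first exact: par_subalgebra.
  + by move=> x y px cy; apply: (lie_par_corner Pu).
  + by move=> x y cx; apply: (lie_corner_any Pu).
  + by move=> x y cx cy; apply: (lie_corner Pu) cx cy.
- by case: sC.
- exact: supp_subspace.
- exact: upper_par.
- have V10 : corner P (cuts T) 0 by case: sC.
  move=> _ [w Sw <-]; have [bw|->] := Sb _ Sw.
    have Tw : T w by [].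
    rewrite (neg_vector_t0 Tb) //; apply: graded_par_t0 => //.
    exact: (neg_root_par Pu chark eP).
  rewrite /aff_neg_vector /= nlam ec; split=> [i i1||]; rewrite /= monoE.
  + by rewrite ifF //; lia.
  + refine (is_subspaceZ _ sC _); apply/(suppE Pu) => //=.
    by rewrite !leqnn.
  + by case: (supp_subspace P (flag_rel (level (cuts T)) 0)).
- have pW := @parabolic_t0 T S erefl.
  suff: corner P (cuts T) `<=` aff_t (-1) @^-1` aff_parabolic b e S.
    by move=> cW _ [x /cW + <-].
  apply: (corner_sub Pu cutT).
  + split; first by rewrite /preimage /= aff_t_0; case: sW => -[].
    by move=> a y z Wy Wz; rewrite /preimage /= aff_t_linear; case: sW => -[_ +] _; apply.
  + move=> x y px Wy; rewrite /preimage /= -aff_t_lie0; case: sW => _; apply => //.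
    by apply: pW; exists x.
  + apply: (is_subspaceVZ (V := aff_t (-1) @^-1` aff_parabolic b e S) _ c0); last first.
      rewrite -ec; apply: sub_lie_gen; right; exists (alpha0 lambda) => //.
      by rewrite /aff_neg_vector /= nlam.
    split; first by rewrite /preimage /= aff_t_0; case: sW => -[].
    by move=> a y z Wy Wz; rewrite /preimage /= aff_t_linear; case: sW => -[_ +] _; apply.
- exact: (@parabolic_t0 T S erefl).
Qed.

(** The degree [-1] of the parabolic vanishes, so its image stops at degree 0,
    where the transposition of supports yields the opposite parabolic. *)
Lemma omega_graded_par T x : T `<=` simple_roots b ->
  (omega @` graded_par [set 0] (par P (cuts T))) x <->
  (forall i : int, 0 < i -> aff_loop x i = 0) /\ par_opp P (cuts T) (aff_loop x 0).
Proof.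
move=> Tb.
have t0 : t 0 by case: (supp_subspace P eq_op).
have xL := omega_loop omegaP t0.
have flagE : par P (cuts T) = coord_supp P (fun i j => (cuts T i <= cuts T j)%N).
  by apply/seteqP; split; apply: suppS => i j; rewrite /flag_rel addn0.
split=> [[y [ylow y1 y0] <-]|[xhigh x0]].
  split=> [i i0|]; rewrite xL.
    have [->|i1] : i = 1 \/ - i < -1 by lia.
      by rewrite [aff_loop _ _]y1 (omega_t0 omegaP).
    by rewrite ylow // (omega_t0 omegaP).
  rewrite oppr0; move: y0; rewrite flagE.
  exact: (sigma_supp Pu chark omegaP (R := fun i j => (cuts T i <= cuts T j)%N)).
exists (omega x); last exact: (omegaK omegaP).
split=> [i i1||]; rewrite xL.
- by rewrite xhigh ?(omega_t0 omegaP) //; lia.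
- by rewrite xhigh ?(omega_t0 omegaP).
- rewrite oppr0 flagE; apply/(sigma_suppP Pu chark omegaP).
  exact: x0.
Qed.

Lemma aff_seaweedE S T (V1 : set g) : T `<=` simple_roots b ->
  aff_parabolic b e S = graded_par V1 (par P (cuts (S `&` simple_roots b))) ->
  aff_seaweed b e omega S T =
  set_add (set_add (set_add
    (aff_t 0 @` (par P (cuts (S `&` simple_roots b)) `&` par_opp P (cuts T)))
    (line (aff_d k r))) (line (aff_C k r))) (aff_t (-1) @` V1).
Proof.
move=> Tb SE; rewrite /aff_seaweed SE aff_parabolic_finite //.
apply/seteqP; split=> x.
  move=> [[xlow x1 x0] /(omega_graded_par _ Tb)[xhigh x0']].
  apply/two_graded_sum; split=> // i i0 i1.
  by have [/xlow|/xhigh] : i < -1 \/ 0 < i by lia.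
move=> /two_graded_sum[xoff x1 [x0 x0']]; split.
  by split=> // i i1; apply: xoff; lia.
by apply/(omega_graded_par _ Tb); split=> // i i0; apply: xoff; lia.
Qed.

(** Both parabolics contain the diagonal, one all upper and the other all lower
    triangular elements, whence the sum condition. *)
Lemma par_seaweed (beta beta' : nat -> nat) : is_split_cartan t ->
  {homo beta : i j / (i <= j)%N} -> {homo beta' : i j / (i <= j)%N} ->
  is_seaweed (par P beta `&` par_opp P beta').
Proof.
move=> sct bm bm'; exists (par P beta), (par_opp P beta').
(* The lower triangular matrices stabilise the flag of the reversed order. *)
have revI : injective (fun i : I => r - i)%N.
  by move=> i j ij; apply: val_inj => /=; have := ltn_ord i; have := ltn_ord j; lia.
have sp := par_subalgebra Pu beta; have so := par_opp_subalgebra Pu beta'.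
split=> //; [split=> //|split=> //|].
- exists t, (coord_supp P (flag_rel (fun i => i : nat) 0)); split.
    by apply: flag_borel_pair => //; apply: val_inj.
  apply: subset_trans (upper_par (P := P) bm).
  by apply: suppS => i j; rewrite /flag_rel addn0.
- exists t, (coord_supp P (flag_rel (fun i => r - i)%N 0)); split.
    exact: flag_borel_pair.
  apply: subset_trans (lower_par_opp (P := P) bm').
  by apply: suppS => i j; rewrite /flag_rel /lower_rel; have := ltn_ord i; have := ltn_ord j; lia.
apply/seteqP; split=> // x _; have sadd := set_add_subspace sp.1 so.1.
suff: coord_supp P (fun _ _ => true) `<=` set_add (par P beta) (par_opp P beta') by apply.
have addl y : par P beta y -> set_add (par P beta) (par_opp P beta') y.
  by apply: set_addl; case: so => -[].
have addr y : par_opp P beta' y -> set_add (par P beta) (par_opp P beta') y.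
  by apply: set_addr; case: sp => -[].
apply: (supp_sub Pu) => //.
  by move=> y yd; apply/addl/(upper_par bm); apply: suppS yd => i j /eqP->; apply: leqnn.
move=> i j ij _; have [lij|lji] := leqP i j.
  by apply/addl/(upper_par bm)/(suppE Pu).
by apply/addr/(lower_par_opp bm')/(suppE Pu) => //; apply: ltnW.
Qed.

End SeaweedsInCoordinates.

Theorem proposition2p2 (k : fieldType) (chark : [pchar k] =i pred0) (r : nat)
    (t b : set (sl k r)) (tb_borel : is_borel_pair t b)
    (lambda : t -> k) (lambda_highest : is_highest b lambda)
    (e : (t -> k) -> sl k r) (e_root : root_vectors e)
    (omega : affine k r -> affine k r) (omegaP : is_omega t omega)
    (S S' : set (aff_weight t))
    (S_proper : S `<` aff_simple_roots b lambda)
    (S'_sub : S' `<=` simple_roots b) :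
  let qhat := aff_seaweed b e omega S S' in
  let p := parabolic b e (S `&` simple_roots b) in
  let q := p `&` opposite_parabolic b e omega S' in
  let z := centre (nilradical p) in
  let q0 := aff_t 0 @` q in
  let qd := set_add q0 (line (aff_d k r)) in
  let qdC := set_add qd (line (aff_C k r)) in
  let ztinv := aff_t (-1) @` z in
  [/\ is_seaweed q,
      is_direct q0 (line (aff_d k r)),
      is_direct qd (line (aff_C k r)) &
      lie_isog qhat qdC \/
      is_semidirect qdC ztinv /\ lie_isog qhat (set_add qdC ztinv)].
Proof.
have [P Pu [tE bE]] := borel_pair_adapted chark tb_borel.
subst t b; have [_ lambdaE] := is_highestP Pu chark lambda_highest; subst lambda.
pose T := S `&` simple_roots (coord_supp P upper_rel).
have Tb : T `<=` simple_roots (coord_supp P upper_rel) by move=> w [].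
move=> qhat p q z q0 qd qdC ztinv.
have Tm := @cuts_mono _ _ P T; have S'm := @cuts_mono _ _ P S'.
have pE : p = par P (cuts T) by apply: parabolic_par.
have qE : q = par P (cuts T) `&` par_opp P (cuts S').
  by rewrite /q pE (opposite_parabolicE Pu chark e_root omegaP).
have sp := par_subalgebra Pu (cuts T); have so := par_opp_subalgebra Pu (cuts S').
have sq : is_subalgebra q.
  rewrite qE; split; first split.
  - by split; [case: sp => -[]|case: so => -[]].
  - move=> a x y [px ox] [py oy]; split; first by case: sp => -[_ pL] _; apply: pL.
    by case: so => -[_ oL] _; apply: oL.
  - move=> x y [px ox] [py oy]; split; first by case: sp => _; apply.
    by case: so => _; apply.
have sct : is_split_cartan (coord_supp P eq_op) by case: tb_borel.
split; [by rewrite qE; apply: par_seaweed|exact: direct_d|exact: direct_C|].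
have [Sa nSa] := S_proper.
have [S0|S0] := pselect (S (alpha0 (@rt k r P ord0 ord_max))); [right|left].
(* As [S] contains [alpha0] and is proper, it misses a finite simple root. *)
- have cutT : (cuts T 0 < cuts T r)%N.
    have [w [aw nSw]] := nonsubset nSa.
    have bw : simple_roots (coord_supp P upper_rel) w.
      by case: aw => // w0; case: nSw; rewrite w0.
    have [i [j [ji _ wE]]] := simple_rootsP Pu chark (@subset_refl _ _) bw.
    by apply: (cuts_gt0 ji); rewrite -wE => -[].
  have zE : z = corner P (cuts T).
    by rewrite /z pE nilradical_par // centre_par_nil.
  rewrite /ztinv zE; split.
    apply: semidirect_tinv => //; first exact: supp_subspace.
      by rewrite qE => x y [px _]; apply: (lie_par_corner Pu).
    by move=> x y; apply: (lie_corner Pu).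
  rewrite /qhat /qdC /qd /q0 qE.
  rewrite (aff_seaweedE Pu chark e_root omegaP S'_sub (aff_parabolic_affine Pu chark e_root Sa S0 cutT)).
  exact: lie_isog_refl.
- have Sb : S `<=` simple_roots (coord_supp P upper_rel).
    by move=> w Sw; case: (Sa w Sw) => // w0; case: S0; rewrite -w0.
  have TS : T = S by apply/seteqP; split=> [w []//|w Sw]; split=> //; apply: Sb.
  have SE : aff_parabolic (coord_supp P upper_rel) e S =
      graded_par [set 0] (par P (cuts (S `&` simple_roots (coord_supp P upper_rel)))).
    by rewrite -/T TS; apply: aff_parabolic_finite.
  rewrite /qhat (aff_seaweedE Pu chark e_root omegaP S'_sub SE) /qdC /qd /q0 qE.
  rewrite [set_add _ (aff_t (-1) @` _)](_ : _ = set_add (set_add (aff_t 0 @`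
      (par P (cuts T) `&` par_opp P (cuts S'))) (line (aff_d k r))) (line (aff_C k r))).
    exact: lie_isog_refl.
  apply/seteqP; split=> x.
    by move=> [y qy [_ [_ -> <-] <-]]; rewrite aff_t_0 [y + _]addr0.
  by exists x => //; exists 0; [exists 0; rewrite // aff_t_0|rewrite addr0].
Qed.
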